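(* Let $k$ be a field, let $I\subseteq k[x_1,\dots,x_n]$ be a monomial ideal, let $L(I)$ be its lcm-lattice, and let $d$ be a non-negative integer. Then $I$ has a $d$-linear resolution if and only if $L(I)$ is $d$-degree graded and Cohen-Macaulay over $k$.
   Context: Linear resolutions. Let $S=k[x_1,\dots,x_n]$. The graded Betti numbers of $I$ are $\beta_{i,j}(I)=\dim_k \mathrm{Tor}_i^S(I,k)_j$. $I$ has a $d$-linear resolution if $\beta_{i,j}(I)=0$ whenever $j\neq i+d$. Lcm-lattice. Let $G(I)$ be the unique minimal set of monomial generators of $I$. $L(I)$ is the finite atomic lattice whose elements are the least common multiples of all subsets of $G(I)$ (the lcm of the empty set being $1$), ordered by divisibility. Its minimum is $1$, and its atoms are the elements of $G(I)$. Degree-graded. In a poset, $a\prec b$ means $a<b$ and there is no $c$ with $a<c<b$. $L(I)$ is degree-graded if for all $a,b\in L(I)$ with $a\neq 1$ and $b\ne 1$, $a\prec b$ implies $\deg(b)=\deg(a)+1$ (degrees as monomials). It is $d$-degree graded if it is degree-graded and its atoms (the minimal generators of $I$) all have degree $d$. Cohen-Macaulay. The order complex of a finite poset $P$ is the simplicial complex whose vertices are the elements of $P$ and whose faces are the chains of $P$. For a face $F$ of a simplicial complex $\Delta$, $\mathrm{link}_\Delta F=\{T\in\Delta : T\cup F\in\Delta,\ T\cap F=\emptyset\}$. $\Delta$ is Cohen-Macaulay over $k$ if for all $F\in\Delta$ (including $F=\emptyset$), $\tilde H_i(\mathrm{link}_\Delta F;k)=0$ for all $i<\dim(\mathrm{link}_\Delta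 F)$. A finite poset is Cohen-Macaulay over $k$ if its order complex is. *)

(* Defs.v *)
From Stdlib Require Import Classical ClassicalEpsilon.
From mathcomp Require Import all_boot all_order all_algebra.
From mathcomp Require Import finmap mpoly.

Set Implicit Arguments.
Unset Strict Implicit.
Unset Printing Implicit Defensive.

Import GRing.Theory.
Local Open Scope ring_scope.

(** * Monomial ideals *)

Section MonomialIdeals.
Variables (k : fieldType) (n : nat).
Implicit Types (I : {mpoly k[n]} -> Prop) (M : 'X_{1..n} -> Prop).

(* The ideal (x^m : M m), as the set of all finite sums of p * x^m. *)
Definition mon_ideal M (f : {mpoly k[n]}) : Prop :=
  exists s : seq ({mpoly k[n]} * 'X_{1..n}),
    (forall t, t \in s -> M t.2) /\ f = \sum_(t <- s) t.1 * 'X_[t.2].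

Definition monomial_ideal I : Prop :=
  exists M, forall f, I f <-> mon_ideal M f.

Definition generates (G : {fset 'X_{1..n}}) I : Prop :=
  forall f, I f <-> mon_ideal (fun m => m \in G) f.

Definition min_generating I (G : {fset 'X_{1..n}}) : Prop :=
  generates G I /\ forall H : {fset 'X_{1..n}}, (H `<` G)%fset -> ~ generates H I.

(* G(I); see [mingensP] and [min_generating_uniq] for existence (Dickson's
   lemma) and uniqueness. *)
Definition mingens I : {fset 'X_{1..n}} :=
  epsilon (inhabits fset0) (min_generating I).

Lemma dickson (A : {set 'I_n}) M :
  (forall m m', M m -> M m' -> forall i, i \notin A -> m i = m' i) ->
  exists s : seq 'X_{1..n}, (forall m, m \in s -> M m) /\
    (forall m, M m -> exists2 m', m' \in s & (m' <= m)%MM).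
Proof.
move: {2}#|A| (leqnn #|A|) => N.
elim: N A M => [|N IH] A M leA agree.
  have [[m0 Mm0]|nM] := classic (exists m, M m).
    exists [:: m0]; split=> [m|m Mm]; first by rewrite inE => /eqP->.
    exists m0; first by rewrite inE.
    apply/mnm_lepP => i; rewrite (agree m0 m) //.
    by move: leA; rewrite leqn0 cards_eq0 => /eqP->; rewrite inE.
  by exists [::]; split=> // m Mm; case: nM; exists m.
have [[m0 Mm0]|nM] := classic (exists m, M m); last first.
  by exists [::]; split=> // m Mm; case: nM; exists m.
have low (i : 'I_n) : exists s : seq 'X_{1..n}, (forall m, m \in s -> M m) /\
    (forall m, M m -> i \in A -> (m i < m0 i)%N ->
       exists2 m', m' \in s & (m' <= m)%MM).
  elim: (m0 i) => [|c [s [sM sdom]]]; first by exists [::].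
  have [iA|iNA] := boolP (i \in A); last by exists [::]; split.
  have [||t [tM tdom]] := IH (A :\ i) (fun m => M m /\ m i = c).
  - by move: leA; rewrite (cardsD1 i A) iA.
  - move=> m m' [Mm mi] [Mm' m'i] j; rewrite !inE negb_and negbK.
    by case/orP=> [/eqP->|jNA]; [rewrite mi m'i | apply: agree].
  exists (t ++ s); split=> [m|m Mm _].
    by rewrite mem_cat => /orP[/tM[]|/sM].
  rewrite ltnS leq_eqVlt => /orP[/eqP mi|mi].
    have [m' m't le] := tdom m (conj Mm mi).
    by exists m'; rewrite ?mem_cat ?m't.
  have [m' m's le] := sdom m Mm iA mi.
  by exists m'; rewrite // mem_cat m's orbT.
have [F FP] := fin_all_exists low.
exists (m0 :: flatten [seq F i | i <- enum 'I_n]); split=> [m|m Mm].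
  rewrite inE => /orP[/eqP->//|/flattenP[_ /mapP[i _ ->]]].
  exact: (FP i).1.
have [le|/mnm_lepP nle] := boolP (m0 <= m)%MM; first by exists m0; rewrite ?mem_head.
have [i] := not_all_ex_not _ _ nle; move/negP; rewrite -ltnNge => lti.
have iA : i \in A by apply: contraLR lti => iNA; rewrite (agree m m0) // ltnn.
have [m' m'F le] := (FP i).2 m Mm iA lti.
exists m' => //; rewrite inE; apply/orP; right.
by apply/flattenP; exists (F i) => //; apply: map_f; rewrite mem_enum.
Qed.

Lemma mon_idealX M m : mon_ideal M 'X_[m] <-> exists2 g, M g & (g <= m)%MM.
Proof.
split=> [[s [sM def]]|[g Mg le]]; last first.
  exists [:: ('X_[m - g], g)]; split=> [t|]; first by rewrite inE => /eqP->.
  by rewrite big_seq1 -mpolyXD submK.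
have: (\sum_(t <- s) t.1 * 'X_[t.2])@_m != 0.
  by rewrite -def mcoeffX eqxx oner_neq0.
rewrite raddf_sum /= => nz.
have [/hasP[t ts tnz]|/hasPn all0] := boolP (has (fun t => (t.1 * 'X_[t.2])@_m != 0) s).
  exists t.2; first exact: sM.
  move: tnz; rewrite mcoeff_eq0 negbK => /msuppM_le /allpairsP[[a b] /= [_]].
  by rewrite msuppX inE => /eqP-> ->; rewrite lem_addl.
by case/eqP: nz; apply: big1_seq => t /andP[_ /all0]; rewrite negbK => /eqP.
Qed.

Lemma mon_ideal_sub M M' :
  (forall m, M m -> exists2 g, M' g & (g <= m)%MM) ->
  forall f, mon_ideal M f -> mon_ideal M' f.
Proof.
move=> sub f [s [sM ->{f}]]; elim: s sM => [|t s IH] sM.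
  by exists [::]; rewrite !big_nil.
rewrite big_cons; have [|u [uM' ->]] := IH; first by move=> x xs; apply: sM; rewrite inE xs orbT.
have [g M'g le] := sub t.2 (sM t (mem_head _ _)).
exists ((t.1 * 'X_[t.2 - g], g) :: u); split=> [x|].
  by rewrite inE => /orP[/eqP->//|/uM'].
by rewrite big_cons /= -mulrA -mpolyXD submK.
Qed.

Lemma min_generating_exists I : monomial_ideal I -> exists G, min_generating I G.
Proof.
case=> M IM.
have [|s [sM sdom]] := @dickson setT M; first by move=> m m' _ _ i; rewrite inE.
have: generates [fset m in s]%fset I.
  move=> f; rewrite IM; split; apply: mon_ideal_sub => m.
    by move/sdom => [g gs le]; exists g => //; rewrite in_fset.
  by rewrite in_fset => /sM Mm; exists m => //; apply: lepm_refl.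
move: [fset m in s]%fset => G; move: {2}#|`G| (leqnn #|`G|) => N.
elim: N G => [|N IH] G leG genG.
  exists G; split=> // H /fproper_ltn_card.
  by move: leG; rewrite leqn0 => /eqP->.
have [[H ltH genH]|min] := classic (exists2 H, (H `<` G)%fset & generates H I).
  by apply: (IH H) => //; rewrite -ltnS (leq_trans (fproper_ltn_card ltH)).
by exists G; split=> // H ltH genH; apply: min; exists H.
Qed.

Lemma mingensP I : monomial_ideal I -> min_generating I (mingens I).
Proof. by move=> /min_generating_exists; apply: epsilon_spec. Qed.

Lemma min_generating_uniq I G H :
  min_generating I G -> min_generating I H -> G = H.
Proof.
suff sub G1 G2 : min_generating I G1 -> min_generating I G2 -> (G1 `<=` G2)%fset.
  by move=> mG mH; apply/eqP; rewrite eqEfsubset !sub.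
move=> [gen1 min1] [gen2 _]; apply/fsubsetP => g gG.
have gen_div G' m : generates G' I -> I 'X_[m] -> exists2 g', g' \in G' & (g' <= m)%MM.
  by move=> gen /gen /mon_idealX.
have memI G' m : generates G' I -> m \in G' -> I 'X_[m].
  by move=> gen mG'; apply/gen/mon_idealX; exists m => //; apply: lepm_refl.
have [h hG2 leh] := gen_div _ g gen2 (memI _ _ gen1 gG).
have [g' g'G leg'] := gen_div _ h gen1 (memI _ _ gen2 hG2).
have [eqg|neq] := eqVneq g' g.
  suff -> : g = h by [].
  apply/mnmP => i; apply/eqP; rewrite eqn_leq.
  by move/mnm_lepP: leh => ->; rewrite -eqg; move/mnm_lepP: leg' => ->.
case: (min1 (G1 `\ g)%fset); first by rewrite fproperD1.
move=> f; rewrite gen1; split; apply: mon_ideal_sub => m.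
  move=> mG; have [->|nm] := eqVneq m g.
    by exists g'; [rewrite !inE neq | apply: lepm_trans leh].
  by exists m; [rewrite !inE nm | apply: lepm_refl].
by rewrite !inE => /andP[_ mG]; exists m => //; apply: lepm_refl.
Qed.

End MonomialIdeals.

(** * Graded Betti numbers and linear resolutions *)

Section Betti.
Variables (k : fieldType) (n : nat).
Implicit Types I : {mpoly k[n]} -> Prop.

(* An augmented sequence of graded free S-modules of finite rank
   ... -> F_1 -> F_0 -> S.  F_i has basis 'I_(rk i), its elements are row
   vectors, and maps act by right multiplication; [dif i] is the differential
   F_(i+1) -> F_i. *)
Record free_seq := FreeSeq {
  rk : nat -> nat;
  dg : forall i, 'I_(rk i) -> int;
  dif : forall i, 'M[{mpoly k[n]}]_(rk i.+1, rk i);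
  aug : 'cV[{mpoly k[n]}]_(rk 0)
}.

Record graded_free_resolution (F : free_seq) I : Prop := GradedFreeResolution {
  dif_homog : forall i a b (m : 'X_{1..n}), m \in msupp (dif F i a b) ->
    (mdeg m)%:Z + dg b = dg a;
  aug_homog : forall a (m : 'X_{1..n}), m \in msupp (aug F a 0) ->
    (mdeg m)%:Z = dg a;
  aug_onto : forall f, I f <-> exists v : 'rV_(rk F 0), f = (v *m aug F) 0 0;
  exact_0 : forall v : 'rV_(rk F 0),
    v *m aug F = 0 <-> exists w : 'rV_(rk F 1), v = w *m dif F 0;
  exact_S : forall i (v : 'rV_(rk F i.+1)),
    v *m dif F i = 0 <-> exists w : 'rV_(rk F i.+2), v = w *m dif F i.+1
}.

Section Tor.
Variable F : free_seq.

(* Tensoring with k = S/(x_1, ..., x_n) keeps the constant coefficients. *)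
Definition dif_k i : 'M[k]_(rk F i.+1, rk F i) := map_mx (mcoeff 0%MM) (dif F i).

(* The row space of [strand i j] is the degree j component of F_i (x) k. *)
Definition strand i (j : int) : 'M[k]_(rk F i) :=
  diag_mx (\row_a (dg a == j)%:R).

Definition tor_cycles i j : 'M[k]_(rk F i) :=
  match i with
  | 0 => strand 0 j
  | i'.+1 => (strand i'.+1 j :&: kermx (dif_k i'))%MS
  end.

Definition tor_boundaries i j : 'M[k]_(rk F i.+1, rk F i) :=
  strand i.+1 j *m dif_k i.

(* dim_k H_i(F (x) k)_j *)
Definition tor_dim i j : nat := (\rank (tor_cycles i j) - \rank (tor_boundaries i j))%N.

End Tor.

(* beta_{i,j}(I) = dim_k Tor_i(I, k)_j, computed from a graded free resolution
   of I; the choice of the resolution is immaterial. *)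
Definition betti I (i : nat) (j : int) : nat :=
  epsilon (inhabits 0%N)
    (fun b => exists2 F, graded_free_resolution F I & b = tor_dim F i j).

Definition linear_resolution (d : nat) I : Prop :=
  forall (i : nat) (j : int), j <> (i + d)%N%:Z -> betti I i j = 0%N.

End Betti.

(** * The lcm-lattice *)

Section LcmLattice.
Variables (k : fieldType) (n : nat).
Variable I : {mpoly k[n]} -> Prop.

Definition lcm_set : {fset 'X_{1..n}} :=
  [fset \big[@mlcm n/0%MM]_(g <- (A : {fset 'X_{1..n}})) g | A in fpowerset (mingens I)]%fset.

Definition lcm_lattice : finType := lcm_set.

Definition lcm_le : rel lcm_lattice := fun a b => (val a <= val b)%MM.

End LcmLattice.

(** * Posets and simplicial complexes *)

(* A finite poset is given by a finite type with its order relation. *)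
Definition strict (T : finType) (le : rel T) : rel T :=
  fun a b => (a != b) && le a b.

Definition covers (T : finType) (le : rel T) (a b : T) : Prop :=
  strict le a b /\ ~ exists c, strict le a c /\ strict le c b.

(* The identity element 1 of the lattice is the monomial 0%MM. *)
Definition degree_graded (k : fieldType) n (I : {mpoly k[n]} -> Prop) : Prop :=
  forall a b : lcm_lattice I, val a <> 0%MM -> val b <> 0%MM ->
    covers (@lcm_le k n I) a b -> mdeg (val b) = (mdeg (val a)).+1.

(* Requiring degree d of the minimal generators, and not of the atoms, matters
   only for the unit ideal, whose generator 1 is not an atom. *)
Definition d_degree_graded (d : nat) (k : fieldType) n
    (I : {mpoly k[n]} -> Prop) : Prop :=
  degree_graded I /\ forall m, m \in mingens I -> mdeg m = d.

Definition order_complex (T : finType) (le : rel T) : {set {set T}} :=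
  [set F : {set T} | [forall a in F, forall b in F, le a b || le b a]].

Section SimplicialComplex.
Variable V : finType.
Implicit Types (D : {set {set V}}) (F : {set V}).

Definition link D F : {set {set V}} :=
  [set T in D | (T :|: F \in D) && (T :&: F == set0)].

Definition face_dim F : int := #|F|%:Z - 1.

(* -1 for the complex {set0}. *)
Definition dim D : int := (\max_(F in D) #|F|)%N%:Z - 1.

Variable k : fieldType.

(* Reduced simplicial chains, the vertices being ordered by [enum_rank]. *)
Definition is_chain D (i : int) (z : {ffun {set V} -> k}) : Prop :=
  forall F, z F != 0 -> F \in D /\ face_dim F = i.

Definition boundary (z : {ffun {set V} -> k}) : {ffun {set V} -> k} :=
  [ffun F : {set V} => \sum_(v | v \notin F)
    (-1) ^+ #|[set w in F | (enum_rank w < enum_rank v)%N]| * z (v |: F)].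

Definition reduced_homology_vanishes D (i : int) : Prop :=
  forall z, is_chain D i z -> boundary z = 0 ->
    exists2 w, is_chain D (i + 1) w & boundary w = z.

Definition cohen_macaulay D : Prop :=
  forall F, F \in D -> forall i : int, i < dim (link D F) ->
    reduced_homology_vanishes (link D F) i.

End SimplicialComplex.

Definition cohen_macaulay_poset (k : fieldType) (T : finType) (le : rel T) : Prop :=
  cohen_macaulay k (order_complex le).

(* Main.v *)
Require Import Defs.
From HB Require Import structures.
From Stdlib Require Import Classical ClassicalEpsilon.
From mathcomp Require Import all_boot all_order all_algebra.
From mathcomp Require Import finmap mpoly zify.

(* Let P be the set of elements of L(I) lying in I, that is, L(I) minus its
   minimum when I is proper. The order complex of P, each chain labelled by its
   maximum, supports a graded free resolution of I: in multidegree m it is the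
   chain complex of {p in P : p <= m}, a cone. Tensoring with k leaves in
   multidegree m the chains with maximum m, so that Tor_i(I, k)_m is the reduced
   homology of the open interval (1, m) in dimension i - 1, and I has a d-linear
   resolution iff this homology vanishes whenever deg m <> i + d.
   If L(I) is d-degree graded, (1, m) has dimension deg m - d - 1 and is the link
   of a chain, which settles one implication. Conversely, taking i = 0, 1, any two
   generators are joined by a path of generators dividing their lcm with
   consecutive lcms of degree d + 1; hence covers a < b with a <> 1 have
   b = a x_l. Then let F be a chain containing the extremes and let a < b be
   consecutive in F, with a <> 1 and a x_l in between. Joining with a x_l contracts
   the link of F, once the only element b / x_l whose join with it is b has been
   removed; the link of that element belongs to a longer chain. By induction only
   the links (1, a) remain. *)

Set Implicit Arguments.
Unset Strict Implicit.
Unset Printing Implicit Defensive.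

Import GRing.Theory.
Local Open Scope ring_scope.

(** * Order complexes *)

Section Chains.
Variables (k : fieldType) (T : finType).
Implicit Types (F G : {set T}) (v w c : T) (x y z u : {ffun {set T} -> k}).

Definition incidence v F : k :=
  (-1) ^+ #|[set w in F | (enum_rank w < enum_rank v)%N]|.

Lemma boundaryE z F :
  boundary z F = \sum_(v | v \notin F) incidence v F * z (v |: F).
Proof. by rewrite ffunE. Qed.

Lemma incidence_sqr v F : incidence v F * incidence v F = 1.
Proof. by rewrite -expr2 sqrr_sign. Qed.

Lemma incidenceU v w F : w \notin F ->
  incidence v (w |: F) =
  if (enum_rank w < enum_rank v)%N then - incidence v F else incidence v F.
Proof.
move=> wF; rewrite /incidence; case: ifP => lt.
  rewrite -[RHS]mulN1r -exprS; congr (_ ^+ _).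
  have -> : [set x in w |: F | (enum_rank x < enum_rank v)%N] =
    w |: [set x in F | (enum_rank x < enum_rank v)%N].
    by apply/setP => x; rewrite !inE; case: eqP => [->|_]; rewrite ?lt ?orbF.
  by rewrite cardsU1 inE (negPf wF).
congr (_ ^+ #|pred_of_set _|); apply/setP => x; rewrite !inE.
by case: eqP => [->|//]; rewrite lt !andbF.
Qed.

Lemma incidence_self v F : incidence v (v |: F) = incidence v F.
Proof.
have [vF|vF] := boolP (v \in F); first by rewrite (setUidPr _) ?sub1set.
by rewrite incidenceU // ltnn.
Qed.

Lemma incidenceD1 v F : incidence v (F :\ v) = incidence v F.
Proof.
have [vF|vF] := boolP (v \in F); first by rewrite -{2}(setD1K vF) incidence_self.
by congr incidence; apply/setDidPl; rewrite disjoint_sym disjoints1.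
Qed.

Lemma boundary_is_zmod_morphism : zmod_morphism (@boundary T k).
Proof.
move=> x y; apply/ffunP => F; rewrite !ffunE -sumrB.
by apply: eq_bigr => v _; rewrite !ffunE mulrBr.
Qed.
HB.instance Definition _ := GRing.isZmodMorphism.Build
  {ffun {set T} -> k} {ffun {set T} -> k} (@boundary T k) boundary_is_zmod_morphism.

(** Each pair of added vertices occurs in both orders. Splitting the double sum by rank matches
    these two terms, whose signs are opposite. *)
Lemma boundary_boundary z : boundary (boundary z) = 0.
Proof.
apply/ffunP => F; rewrite boundaryE [RHS]ffunE.
pose g v w := incidence v F * incidence w (v |: F) * z (w |: (v |: F)).
pose Q v w := [&& v \notin F, w \notin F & v != w].
transitivity (\sum_v \sum_(w | Q v w) g v w).
  rewrite big_mkcond /=; apply: eq_bigr => v _.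
  rewrite /Q; case: (v \in F) => /=; first by rewrite big_pred0_eq.
  rewrite boundaryE mulr_sumr; apply: eq_big => [w|w _]; last by rewrite mulrA.
  by rewrite !inE negb_or andbC eq_sym.
have split_rank v : \sum_(w | Q v w) g v w =
    \sum_(w | Q v w && (enum_rank v < enum_rank w)%N) g v w +
    \sum_(w | Q w v && (enum_rank w < enum_rank v)%N) g v w.
  rewrite (bigID (fun w => enum_rank v < enum_rank w)%N) /=; congr (_ + _).
  apply: eq_bigl => w; rewrite /Q [v == w]eq_sym -leqNgt leq_eqVlt.
  have [-> | neq] := eqVneq w v; first by rewrite !andbF.
  have -> : ((enum_rank w : nat) == enum_rank v) = false.
    by apply: contra_neqF neq => /eqP/val_inj/enum_rank_inj.
  by rewrite !andbT [(w \notin F) && _]andbC.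
rewrite (eq_bigr _ (fun v _ => split_rank v)) big_split /=.
rewrite [X in _ + X](exchange_big_dep predT) //= -big_split big1 //= => v _.
rewrite -big_split big1 //= => w /andP[/and3P[vF wF neq] _].
rewrite /g setUCA -mulrDl mulrC.
suff -> : incidence v F * incidence w (v |: F) + incidence w F * incidence v (w |: F) = 0.
  by rewrite mulr0.
rewrite !incidenceU //; case: ltngtP => [_|_|/val_inj/enum_rank_inj e].
- by rewrite mulrN mulrC addNr.
- by rewrite mulrN mulrC addrN.
by rewrite e eqxx in neq.
Qed.

(** The signed join with the vertex [c]; it reads [u] only on faces avoiding [c]. *)
Definition cone c u : {ffun {set T} -> k} :=
  [ffun F : {set T} => if c \in F then incidence c F * u (F :\ c) else 0].

Lemma cone_is_zmod_morphism c : zmod_morphism (cone c).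
Proof.
move=> x y; apply/ffunP => F; rewrite !ffunE.
by case: ifP => _; rewrite ?mulrBr ?subr0.
Qed.
HB.instance Definition _ c := GRing.isZmodMorphism.Build
  {ffun {set T} -> k} {ffun {set T} -> k} (cone c) (cone_is_zmod_morphism c).

Lemma cone_eq0 c z : (forall F, c \in F -> z F = 0) -> cone c z = 0 -> z = 0.
Proof.
move=> z0 /ffunP cz; apply/ffunP => F; rewrite [RHS]ffunE.
have [/z0//|cF] := boolP (c \in F).
have := cz (c |: F); rewrite !ffunE setU11 setU1K // => /eqP.
by rewrite mulf_eq0 signr_eq0 => /eqP.
Qed.

(** Coning is a contracting homotopy. On a face without [c] only the added vertex [c] contributes.
    On a face through [c], the term of [c] gives back [u] and the terms of the other vertices cancel
    by [incidenceU]. *)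
Lemma boundary_cone c u : boundary (cone c u) + cone c (boundary u) = u.
Proof.
apply/ffunP => F; rewrite [LHS]ffunE boundaryE [cone _ (boundary u) F]ffunE.
have [cF|cF] := boolP (c \in F); last first.
  rewrite addr0 (bigD1 c) //= big1 ?addr0 => [|v /andP[vF vc]]; last first.
    by rewrite ffunE in_setU1 eq_sym (negPf vc) (negPf cF) mulr0.
  by rewrite ffunE setU11 incidence_self mulrA incidence_sqr mul1r setU1K.
pose G := F :\ c; have cG : c \notin G by rewrite !inE eqxx.
have {cF} -> : F = c |: G by rewrite setD1K.
rewrite setU1K // boundaryE (bigD1 (P := fun v => v \notin G) c) //=.
rewrite mulrDr addrCA incidence_self [X in X + _]mulrA incidence_sqr mul1r -[RHS]addr0.
congr (_ + _); rewrite mulr_sumr.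
rewrite [X in X + _](eq_bigl (fun v => (v \notin G) && (v != c))); last first.
  by move=> v; rewrite in_setU1 negb_or andbC.
rewrite -big_split big1 //= => v /andP[vG vc].
rewrite ffunE setUCA setU11 setU1K; last by rewrite in_setU1 negb_or eq_sym vc.
rewrite incidence_self !mulrA -mulrDl incidenceU // [incidence c _]incidenceU //.
rewrite [incidence c G * _]mulrC.
case: ltngtP => [_|_|/val_inj/enum_rank_inj e]; rewrite ?mulNr ?mulrN ?addNr ?mul0r //.
by rewrite e eqxx in vc.
Qed.

End Chains.

(** * Acyclicity of order complexes and of links *)

Section OrderComplexes.
Variables (k : fieldType) (T : finType) (le : rel T).
Hypotheses (le_refl : reflexive le) (le_anti : antisymmetric le) (le_trans : transitive le).
Implicit Types (F G W : {set T}) (v w c : T) (x y z u : {ffun {set T} -> k}) (n : nat).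

Definition comparable v w := le v w || le w v.

Lemma comparable_sym v w : comparable v w = comparable w v.
Proof. exact: orbC. Qed.

Definition chain F := F \in order_complex le.

Lemma chainP F :
  reflect (forall v w, v \in F -> w \in F -> comparable v w) (chain F).
Proof.
rewrite /chain inE; apply: (iffP forall_inP) => [H v w vF wF | H v vF].
  exact: (forall_inP (H v vF)).
by apply/forall_inP => w wF; apply: H.
Qed.

Lemma chainS F G : G \subset F -> chain F -> chain G.
Proof.
by move=> /subsetP sub /chainP H; apply/chainP => v w /sub vF /sub wF; apply: H.
Qed.

Lemma chain0 : chain set0.
Proof. by apply/chainP => v w; rewrite inE. Qed.

Lemma chainU1 v F :
  chain (v |: F) <-> chain F /\ (forall w, w \in F -> comparable v w).
Proof.
split=> [H|[HF Hv]].
  split; first by apply: chainS H; apply: subsetUr.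
  by move=> w wF; apply: (chainP _ H); rewrite ?setU11 // setU1r.
apply/chainP => a b; rewrite !inE.
case/orP=> [/eqP->|aF] /orP[/eqP->|bF].
- by rewrite /comparable le_refl.
- exact: Hv.
- by rewrite comparable_sym; apply: Hv.
exact: (chainP _ HF).
Qed.

(* The number of elements [n] of a face is one more than its dimension. *)
Definition supported W n z : Prop :=
  forall F, z F != 0 -> [/\ chain F, F \subset W & #|F| = n].

(** Vanishing of the reduced homology of the order complex of [W] in dimension [n - 1]; for [n = 0]
    it amounts to [W] being nonempty. *)
Definition acyclic_at W n : Prop :=
  forall z, supported W n z -> boundary z = 0 ->
    exists2 y, supported W n.+1 y & boundary y = z.

Lemma supported0 W n : supported W n (0 : {ffun {set T} -> k}).
Proof. by move=> F; rewrite ffunE eqxx. Qed.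

Lemma supportedD W n z u : supported W n z -> supported W n u -> supported W n (z + u).
Proof.
move=> Hz Hu F; rewrite ffunE => nz.
have [z0|/Hz//] := eqVneq (z F) 0.
by apply: Hu; rewrite z0 add0r in nz.
Qed.

Lemma supportedN W n z : supported W n z -> supported W n (- z).
Proof. by move=> Hz F; rewrite ffunE oppr_eq0; apply: Hz. Qed.

Lemma supportedS W W' n z : W \subset W' -> supported W n z -> supported W' n z.
Proof. by move=> sub Hz F /Hz[cF FW ->]; split=> //; apply: subset_trans sub. Qed.

Lemma supported_boundary W n z : supported W n.+1 z -> supported W n (boundary z).
Proof.
move=> Hz F nz.
have [v vF zv] : exists2 v, v \notin F & z (v |: F) != 0.
  apply/exists_inP; apply: contraNT nz => /exists_inPn H.
  rewrite boundaryE big1 // => v vF.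
  by move: (H v vF); rewrite negbK => /eqP->; rewrite mulr0.
have [cF FW card] := Hz _ zv; split.
- by apply: chainS cF; apply: subsetUr.
- by apply: subset_trans FW; apply: subsetUr.
by apply/eqP; move: card; rewrite cardsU1 vF add1n => -[->].
Qed.

Lemma boundary_supported0 W z : supported W 0 z -> boundary z = 0.
Proof.
move=> Hz; apply/ffunP => F; rewrite boundaryE [RHS]ffunE big1 // => v vF.
have [->|/Hz[_ _ /cards0_eq/setP/(_ v)]] := eqVneq (z (v |: F)) 0; first by rewrite mulr0.
by rewrite setU11 inE.
Qed.

Definition neighbours W c := [set w in W | (w != c) && comparable w c].

Lemma supported_cone W n c u : c \in W ->
  supported (neighbours W c) n u -> supported W n.+1 (cone c u).
Proof.
move=> cW Hu F; rewrite ffunE; case: ifP => [cF|]; last by rewrite eqxx.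
rewrite mulf_eq0 negb_or => /andP[_ /Hu[chF sub card]]; split.
- rewrite -(setD1K cF); apply/chainU1; split=> // w wF.
  by move/subsetP/(_ w wF): sub; rewrite inE comparable_sym => /and3P[].
- apply/subsetP => w wF; have [->//|neq] := eqVneq w c.
  have /(subsetP sub) : w \in F :\ c by rewrite !inE neq.
  by rewrite inE => /andP[].
by rewrite (cardsD1 c) cF card.
Qed.

Lemma acyclic_cone W n c : c \in W -> (forall w, w \in W -> comparable w c) ->
  acyclic_at W n.
Proof.
move=> cW cmp z Hz bz0.
exists (cone c z); last by rewrite -[RHS](boundary_cone c) bz0 raddf0 addr0.
move=> F; rewrite ffunE; case: ifP => [cF|]; last by rewrite eqxx.
rewrite mulf_eq0 negb_or => /andP[_ /Hz[chF sub card]]; split.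
- rewrite -(setD1K cF); apply/chainU1; split=> // w wF.
  by rewrite comparable_sym cmp // (subsetP sub).
- by rewrite -(setD1K cF) subUset sub1set cW.
by rewrite (cardsD1 c) cF card.
Qed.

(** A piece of the Mayer-Vietoris sequence for the deletion and the star of [c], which meet in the
    link of [c], the order complex of [neighbours W c]. *)
Lemma acyclic_add_vertex W n c : c \in W ->
  acyclic_at (W :\ c) n ->
  ((0 < n)%N -> acyclic_at (neighbours W c) n.-1) ->
  acyclic_at W n.
Proof.
move=> cW acD acL z Hz bz0.
(* The faces through [c] are written as a cone: [z] is [cone c y + z0], with [y] in the link of [c]
   and [z0] in the deletion. *)
pose y : {ffun {set T} -> k} :=
  [ffun F : {set T} => if c \in F then 0 else incidence k c F * z (c |: F)].
pose z0 : {ffun {set T} -> k} := [ffun F : {set T} => if c \in F then 0 else z F].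
have zE : z = cone c y + z0.
  apply/ffunP => F; rewrite !ffunE; case: ifP => cF; last by rewrite add0r.
  by rewrite setD11 setD1K // mulrA incidenceD1 incidence_sqr mul1r addr0.
have zero_on (u : {ffun {set T} -> k}) : (forall F, c \in F -> u F = 0) ->
    forall F, c \in F -> boundary u F = 0.
  move=> u0 F cF; rewrite boundaryE big1 // => v vF.
  by rewrite u0 ?mulr0 // setU1r.
have y0 F : c \in F -> y F = 0 by move=> cF; rewrite ffunE cF.
have z00 F : c \in F -> z0 F = 0 by move=> cF; rewrite ffunE cF.
have bz : boundary z = y - cone c (boundary y) + boundary z0.
  by rewrite {1}zE raddfD /= -[in X in X - _](boundary_cone c y) addrK.
(* In [boundary z = 0], the faces through [c] give [boundary y = 0]; what remains is
   [boundary z0 = - y]. *)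
have by0 : boundary y = 0.
  apply/ffunP => F; rewrite [RHS]ffunE.
  have [cF|cF] := boolP (c \in F); first exact: zero_on.
  have z0cF : boundary z0 (c |: F) = 0 by rewrite zero_on ?setU11.
  move: bz z0cF; rewrite bz0; move: (boundary y) (boundary z0) => u u0 /ffunP/(_ (c |: F)).
  rewrite !ffunE setU11 setU1K // sub0r => e u0cF; move: e; rewrite u0cF addr0 => /esym/eqP.
  by rewrite oppr_eq0 mulf_eq0 signr_eq0 => /eqP.
have bz0E : boundary z0 = - y.
  apply/eqP; rewrite -addr_eq0 addrC; move/esym/eqP: bz; rewrite bz0 by0.
  by rewrite raddf0 subr0.
have Hz0 : supported (W :\ c) n z0.
  move=> F; rewrite ffunE; case: ifP => cF; first by rewrite eqxx.
  by move=> /Hz[chF sub card]; split=> //; rewrite subsetD1 sub cF.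
have [u Hu bu] : exists2 u, supported (neighbours W c) n u & boundary u = y.
  have Hy F : y F != 0 -> [/\ chain F, F \subset neighbours W c & #|F|.+1 = n].
    rewrite ffunE; case: ifP => [_|cF]; first by rewrite eqxx.
    rewrite mulf_eq0 negb_or => /andP[_ /Hz[chF sub card]].
    have [chF' cmp] := (chainU1 _ _).1 chF; split=> //.
      apply/subsetP => w wF; rewrite inE (subsetP sub) ?setU1r //= comparable_sym cmp //.
      by rewrite andbT; apply: contraFneq cF => <-.
    by move: card; rewrite cardsU1 cF.
  case: n {Hz Hz0 acD} acL Hy => [|n] acL Hy.
    exists 0; first exact: supported0.
    rewrite raddf0; apply/ffunP => F; rewrite ffunE; apply/esym/eqP/negPn/negP.
    by move=> /Hy[].
  apply: acL => //= F /Hy[chF sub [card]]; split=> //.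
have subN : neighbours W c \subset W :\ c.
  by apply/subsetP => w; rewrite !inE => /and3P[-> -> _].
(* As [u] fills [y] in the link, [z0 + u] is a cycle of the deletion. If [x] fills it, then
   [x - cone c u] fills [z]. *)
have [||x Hx bx] := acD (z0 + u).
- by apply: supportedD => //; apply: supportedS Hu.
- by rewrite raddfD /= bz0E bu addNr.
exists (x - cone c u).
  apply: supportedD; first by apply: supportedS Hx; apply: subD1set.
  by apply: supportedN; apply: supported_cone.
rewrite raddfB /= bx zE -{1}(boundary_cone c u) bu.
by rewrite [boundary _ + _]addrC addrA addrK addrC.
Qed.

(* Removing a minimal vertex [q] incomparable to [c] preserves the hypothesis, and
   the join of [q] with [c] plays the role of [c] in the link of [q]. *)
Lemma acyclic_join_all W c n : c \in W ->
  (forall w, w \in W -> ~~ comparable w c -> exists2 j, j \in W &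
     [/\ le w j, le c j & forall v, v \in W -> le w v -> le c v -> le j v]) ->
  acyclic_at W n.
Proof.
have [N] := ubnP #|W|; elim: N => // N IH in W c n * => ltW cW joins.
pose B := [set w in W | ~~ comparable w c].
have [B0|[b bB]] := set_0Vmem B.
  apply: (acyclic_cone cW) => w wW; apply/negPn/negP => ncmp.
  by have := in_set0 w; rewrite -B0 inE wW ncmp.
pose q := [arg min_(q < b in B) #|[set w in W | le w q]|].
have [qB qmin] : q \in B /\ forall w, w \in B -> le w q -> w = q.
  rewrite /q; case: arg_minnP => // q' q'B min; split=> // w wB lewq.
  have /subset_leqif_card/geq_leqif : [set x in W | le x w] \subset [set x in W | le x q'].
    by apply/subsetP => x; rewrite !inE => /andP[-> /le_trans->].
  rewrite min // => /esym/subsetP/(_ q'); rewrite !inE le_refl.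
  move: q'B; rewrite inE => /andP[-> _] /(_ isT)/= leqw.
  by apply: le_anti; rewrite lewq.
move: qB; rewrite inE => /andP[qW ncmp].
have qc : q != c by apply: contraNneq ncmp => ->; rewrite /comparable le_refl.
have [j jW [leqj lecj jlub]] := joins q qW ncmp.
have jq : j != q by apply: contraNneq ncmp => <-; rewrite /comparable lecj orbT.
apply: (acyclic_add_vertex (c := q)) => //.
  apply: (IH _ c); first by rewrite (cardsD1 q) qW in ltW.
    by rewrite !inE eq_sym qc.
  move=> w; rewrite inE => /andP[wq wW] /(joins w wW)[i iW [lewi leci ilub]].
  exists i; last first.
    by split=> // u; rewrite inE => /andP[_ uW]; apply: ilub.
  by rewrite !inE iW andbT; apply: contraNneq ncmp => <-; rewrite /comparable leci orbT.
move=> _; apply: (IH _ j); last first.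
(* Such a [w] lies above [q], since otherwise it would lie below [j]. It is incomparable to [c], and
   its join with [c] is also its join with [j]. *)
- move=> w; rewrite inE => /and3P[wW wq cmpwq] ncmpwj.
  have leqw : le q w.
    case/orP: cmpwq => // lewq; case/negP: ncmpwj.
    by rewrite /comparable (le_trans lewq leqj).
  have ncmpwc : ~~ comparable w c.
    apply: contra ncmpwj => /orP[lewc|lecw].
      by rewrite /comparable (le_trans lewc lecj).
    by rewrite /comparable jlub ?orbT.
  have [i iW [lewi leci ilub]] := joins w wW ncmpwc.
  exists i.
    rewrite inE iW /comparable (le_trans leqw lewi) orbT andbT.
    by apply: contraNneq ncmp => <-; rewrite /comparable leci orbT.
  split=> //; first by apply: jlub => //; apply: le_trans lewi.
  move=> u; rewrite inE => /andP[uW _] lewu leju.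
  by apply: ilub => //; apply: le_trans leju.
- by rewrite inE jW jq /comparable leqj orbT.
apply: (@leq_trans #|W|); last by rewrite -ltnS.
rewrite [X in (_ < X)%N](cardsD1 q) qW ltnS.
by apply/subset_leq_card/subsetP => w; rewrite !inE => /and3P[-> -> _].
Qed.

(** The vertices of the link of a chain [F]. By [mem_link] this link is the whole order complex of
    [compat F], so only vertex sets need to be tracked. *)
Definition compat F := [set c | (c \notin F) && [forall w in F, comparable c w]].

Lemma compatP F c :
  reflect (c \notin F /\ forall w, w \in F -> comparable c w) (c \in compat F).
Proof.
rewrite inE; apply: (iffP andP) => [[cF /forall_inP H]|[cF H]]; split=> //.
exact/forall_inP.
Qed.

Lemma neighbours_compat F c : neighbours (compat F) c = compat (c |: F).
Proof.
apply/setP => u; rewrite inE; apply/idP/idP => [/and3P[/compatP[uF cmpu] uc cmp]|].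
  apply/compatP; split=> [|x]; first by rewrite in_setU1 negb_or uc.
  by case/setU1P=> [->|/cmpu].
case/compatP; rewrite in_setU1 negb_or => /andP[uc uF] cmpu; apply/and3P; split=> //.
  by apply/compatP; split=> // x xF; apply: cmpu; rewrite setU1r.
by apply: cmpu; rewrite setU11.
Qed.

Lemma mem_link F G : chain F ->
  (G \in link (order_complex le) F) = chain G && (G \subset compat F).
Proof.
move=> chF; rewrite inE -/(chain G) -/(chain (G :|: F)).
have [/chainP chG|//] := boolP (chain G); apply/idP/idP => /= [/andP[chGF /eqP dis]|/subsetP sub].
  apply/subsetP => c cG; apply/compatP; split=> [|w wF].
    apply/negP => cF; have : c \in G :&: F by rewrite inE cG.
    by rewrite dis inE.
  by apply: (chainP _ chGF); rewrite inE ?cG // wF orbT.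
apply/andP; split.
  apply/chainP => v w; rewrite !inE.
  case/orP=> [vG|vF] /orP[wG|wF]; first exact: chG.
  - by have /compatP[_] := sub v vG; apply.
  - by rewrite comparable_sym; have /compatP[_] := sub w wG; apply.
  exact: (chainP _ chF).
apply/eqP/setP => c; rewrite !inE; apply/negP => /andP[/sub/compatP[cF _]].
by rewrite (negPf cF).
Qed.

Lemma is_chain_link F n z : chain F ->
  is_chain (link (order_complex le) F) (n%:Z - 1) z <-> supported (compat F) n z.
Proof.
move=> chF; split=> H G /H; rewrite mem_link // /face_dim.
  by case=> /andP[chG sub] /addIr[].
by case=> -> -> ->.
Qed.

Lemma reduced_homology_link F n : chain F ->
  reduced_homology_vanishes k (link (order_complex le) F) (n%:Z - 1) <->
  acyclic_at (compat F) n.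
Proof.
move=> chF; have e : n%:Z - 1 + 1 = n.+1%:Z - 1 :> int by rewrite -addn1 PoszD addrAC.
split=> H z Hz bz.
  have [y Hy by_] := H z ((is_chain_link n z chF).2 Hz) bz.
  by exists y => //; apply/(is_chain_link _ _ chF); rewrite -e.
have [y Hy by_] := H z ((is_chain_link n z chF).1 Hz) bz.
by exists y => //; rewrite e; apply/(is_chain_link _ _ chF).
Qed.

Lemma reduced_homology_neg (D : {set {set T}}) (i : int) : i < -1 ->
  reduced_homology_vanishes k D i.
Proof.
move=> lti z Hz _; exists 0.
  by move=> F; rewrite ffunE eqxx.
rewrite raddf0; apply/ffunP => F; rewrite ffunE; apply/esym/eqP/negPn/negP.
by move=> /Hz[_ e]; move: lti; rewrite -e /face_dim; lia.
Qed.

End OrderComplexes.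

(** * Comparison of graded free resolutions *)

Section Comparison.
Variables (k : fieldType) (n : nat).
Local Notation S := {mpoly k[n]}.
Implicit Types (F R : free_seq k n) (i : nat) (e j : int).

(** The homogeneous component of degree [e]. The degree is an integer because entries of graded maps
    have differences of generator degrees as their degrees. *)
Definition hcomp e (p : S) : S :=
  \sum_(m <- msupp p | (mdeg m)%:Z == e) p@_m *: 'X_[m].

Lemma mcoeff_hcomp e p m : (hcomp e p)@_m = if (mdeg m)%:Z == e then p@_m else 0.
Proof.
rewrite /hcomp raddf_sum /=.
under eq_bigr do rewrite mcoeffZ mcoeffX.
have [mp|mp] := boolP (m \in msupp p); last first.
  rewrite (memN_msupp_eq0 mp) if_same big1_seq // => m' /andP[_ m'p].
  by case: eqP => [E|]; [rewrite -E m'p in mp | rewrite mulr0].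
rewrite big_mkcond (bigD1_seq m) //= big1 ?addr0 => [|m' /negPf->].
  by rewrite eqxx mulr1.
by rewrite mulr0 if_same.
Qed.


Definition is_homog e (p : S) := forall m, m \in msupp p -> (mdeg m)%:Z = e.

Lemma hcomp_id e p : is_homog e p -> hcomp e p = p.
Proof.
move=> hp; apply/mpolyP => m; rewrite mcoeff_hcomp; case: eqP => // ne.
apply/esym/eqP; rewrite mcoeff_eq0; apply/negP => /hp.
exact: ne.
Qed.

Lemma homog_hcomp e p : is_homog e (hcomp e p).
Proof. by move=> m; rewrite mcoeff_msupp mcoeff_hcomp; case: ifP => [/eqP|]; rewrite ?eqxx. Qed.

Lemma hcomp_sum e (J : finType) (f : J -> S) :
  hcomp e (\sum_a f a) = \sum_a hcomp e (f a).
Proof.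
have mcoeff_sum m (g : J -> S) : (\sum_a g a)@_m = \sum_a (g a)@_m by apply: raddf_sum.
apply/mpolyP => m; rewrite mcoeff_hcomp !mcoeff_sum.
case: ifP => c; first by apply: eq_bigr => a _; rewrite mcoeff_hcomp c.
by rewrite big1 // => a _; rewrite mcoeff_hcomp c.
Qed.

Lemma homogM e f (p q : S) : is_homog e p -> is_homog f q -> is_homog (e + f) (p * q).
Proof.
move=> hp hq m /msuppM_le/allpairsP[[a b] /= [/hp <- /hq <- ->]].
by rewrite mdegD.
Qed.

Lemma homog_sum e (J : finType) (f : J -> S) :
  (forall a, is_homog e (f a)) -> is_homog e (\sum_a f a).
Proof.
move=> hf m; rewrite mcoeff_msupp raddf_sum /= => nz.
have [|/existsPn H] := boolP [exists a, (f a)@_m != 0].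
  by case/existsP => a; rewrite -mcoeff_msupp => /hf.
by case/eqP: nz; apply: big1 => a _; apply/eqP; rewrite -[_ == _]negbK H.
Qed.

(** The part of [p] outside degree [e - f], multiplied by [q], has no term of degree [e]. *)
Lemma hcompM e f p q : is_homog f q -> hcomp e (p * q) = hcomp (e - f) p * q.
Proof.
move=> hq; apply/mpolyP => m; rewrite mcoeff_hcomp.
have pE : p * q = (p - hcomp (e - f) p) * q + hcomp (e - f) p * q.
  by rewrite -mulrDl subrK.
rewrite pE mcoeffD.
have hpq : is_homog e (hcomp (e - f) p * q).
  by have := homogM (@homog_hcomp (e - f) p) hq; rewrite subrK.
case: eqP => [em|ne].
  rewrite [X in X + _](_ : _ = 0) ?add0r //.
  apply/eqP; rewrite mcoeff_eq0; apply/negP => /msuppM_le/allpairsP[[a b] /= [sa sb mE]].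
  move: sa; rewrite mcoeff_msupp mcoeffB mcoeff_hcomp.
  suff -> : (mdeg a)%:Z == e - f by rewrite subrr eqxx.
  by rewrite -em mE mdegD -(hq b sb) PoszD addrK.
apply/esym/eqP; rewrite mcoeff_eq0; apply/negP => /hpq.
exact: ne.
Qed.

(** Degree-preserving maps between graded free modules whose basis elements have degrees [dr] and
    [ds]. *)
Definition homog_mx r s (dr : 'I_r -> int) (ds : 'I_s -> int) (A : 'M[S]_(r, s)) :=
  forall a b, is_homog (dr a - ds b) (A a b).

Lemma homog_mulmx r s t (dr : 'I_r -> int) (ds : 'I_s -> int) (dt : 'I_t -> int)
    (A : 'M[S]_(r, s)) (B : 'M[S]_(s, t)) :
  homog_mx dr ds A -> homog_mx ds dt B -> homog_mx dr dt (A *m B).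
Proof.
move=> hA hB a c; rewrite mxE; apply: homog_sum => b.
by rewrite -[dr a](subrK (ds b)) -addrA; apply: homogM.
Qed.

Lemma mx_factor r s t (X : 'M[S]_(r, t)) (A : 'M[S]_(s, t)) :
  (forall a, exists w : 'rV_s, row a X = w *m A) -> exists Y, X = Y *m A.
Proof.
case/fin_all_exists => Y YA; exists (\matrix_a Y a).
by apply/row_matrixP => a; rewrite row_mul rowK.
Qed.

(* The homogeneous components of a factor again form a factor. *)
Lemma homog_mx_factor r s t (dr : 'I_r -> int) (ds : 'I_s -> int) (dt : 'I_t -> int)
    (X : 'M[S]_(r, t)) (A : 'M[S]_(s, t)) :
  homog_mx dr dt X -> homog_mx ds dt A ->
  (forall a, exists w : 'rV_s, row a X = w *m A) ->
  exists2 Y, X = Y *m A & homog_mx dr ds Y.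
Proof.
move=> hX hA /mx_factor[Y XE].
exists (\matrix_(a, b) hcomp (dr a - ds b) (Y a b)); last first.
  by move=> a b; rewrite mxE; apply: homog_hcomp.
apply/matrixP => a c; rewrite -(hcomp_id (hX a c)) XE !mxE hcomp_sum.
apply: eq_bigr => b _; rewrite mxE (hcompM _ _ (hA b c)).
by congr (hcomp _ _ * _); rewrite opprB addrA subrK.
Qed.

(** * Comparison maps between two resolutions *)

Section Lift.
Variables (I : S -> Prop) (R F : free_seq k n).
Hypotheses (resR : graded_free_resolution R I) (resF : graded_free_resolution F I).

Lemma dif_homog_mx (G : free_seq k n) i : graded_free_resolution G I ->
  homog_mx (@dg _ _ G i.+1) (@dg _ _ G i) (dif G i).
Proof. by move=> res a b m /(dif_homog res) <-; rewrite addrK. Qed.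

Lemma aug_homog_mx (G : free_seq k n) : graded_free_resolution G I ->
  homog_mx (@dg _ _ G 0) (fun=> 0) (aug G).
Proof. by move=> res a b m; rewrite ord1 subr0; apply: (aug_homog res). Qed.

Lemma dif_aug (G : free_seq k n) : graded_free_resolution G I -> dif G 0 *m aug G = 0.
Proof.
move=> res; apply/row_matrixP => a; rewrite row_mul row0.
by apply/(exact_0 res); exists (delta_mx 0 a); rewrite -rowE.
Qed.

Lemma dif_dif (G : free_seq k n) i : graded_free_resolution G I ->
  dif G i.+1 *m dif G i = 0.
Proof.
move=> res; apply/row_matrixP => a; rewrite row_mul row0.
by apply/(exact_S res); exists (delta_mx 0 a); rewrite -rowE.
Qed.

Let lifts0 X := aug R = X *m aug F /\ homog_mx (@dg _ _ R 0) (@dg _ _ F 0) X.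

Let liftsS i Y X := dif R i *m Y = X *m dif F i /\
  homog_mx (@dg _ _ R i.+1) (@dg _ _ F i.+1) X.

(** A degree-preserving chain map over the identity of [I]. Each choice depends on the previous one;
    it exists because the rows to be factored are cycles of the exact complex [F]. *)
Fixpoint lift_map i : 'M[S]_(rk R i, rk F i) :=
  match i with
  | 0 => epsilon (inhabits 0) lifts0
  | i'.+1 => epsilon (inhabits 0) (liftsS (lift_map i'))
  end.

Lemma lift_map0 : aug R = lift_map 0 *m aug F /\
  homog_mx (@dg _ _ R 0) (@dg _ _ F 0) (lift_map 0).
Proof.
apply: (epsilon_spec (inhabits 0) lifts0).
have [a|Y] := homog_mx_factor (aug_homog_mx resR) (aug_homog_mx resF); last by exists Y.
have [] := (aug_onto resF (aug R a 0)).1.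
  apply/(aug_onto resR); exists (delta_mx 0 a).
  by rewrite -rowE mxE.
by move=> w wE; exists w; apply/rowP => b; rewrite ord1 mxE.
Qed.

Lemma lift_mapS i :
  dif R i *m lift_map i = lift_map i.+1 *m dif F i /\
  homog_mx (@dg _ _ R i.+1) (@dg _ _ F i.+1) (lift_map i.+1).
Proof.
elim: i => [|i [comm hom]];
  apply: (epsilon_spec (inhabits 0) (liftsS (lift_map _))).
  have [comm hom] := lift_map0.
  have hX : homog_mx (@dg _ _ R 1) (@dg _ _ F 0) (dif R 0 *m lift_map 0).
    by apply: homog_mulmx hom; apply: dif_homog_mx.
  have [a|Y] := homog_mx_factor hX (dif_homog_mx resF); last by exists Y.
  apply/(exact_0 resF).
  by rewrite row_mul -!mulmxA -comm -row_mul dif_aug // row0.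
have hX : homog_mx (@dg _ _ R i.+2) (@dg _ _ F i.+1) (dif R i.+1 *m lift_map i.+1).
  by apply: homog_mulmx hom; apply: dif_homog_mx.
have [a|Y] := homog_mx_factor hX (dif_homog_mx resF); last by exists Y.
apply/(exact_S resF).
by rewrite row_mul -!mulmxA -comm !mulmxA -!row_mul dif_dif // mul0mx row0.
Qed.

Lemma lift_map_homog i : homog_mx (@dg _ _ R i) (@dg _ _ F i) (lift_map i).
Proof. by case: i => [|i]; [have [] := lift_map0 | have [] := lift_mapS i]. Qed.

End Lift.

(** * Chain endomorphisms over the identity are homotopic to the identity *)

Section Homotopy.
Variables (I : S -> Prop) (R : free_seq k n) (t : forall i, 'M[S]_(rk R i)).
Hypotheses (resR : graded_free_resolution R I) (t0 : t 0 *m aug R = aug R)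
  (tS : forall i, t i.+1 *m dif R i = dif R i *m t i).

Let homotopies0 X := t 0 - 1%:M = X *m dif R 0.

Let homotopiesS i Y X := t i.+1 - 1%:M - dif R i *m Y = X *m dif R i.+1.

Fixpoint homotopy i : 'M[S]_(rk R i, rk R i.+1) :=
  match i with
  | 0 => epsilon (inhabits 0) homotopies0
  | i'.+1 => epsilon (inhabits 0) (homotopiesS (homotopy i'))
  end.

Lemma homotopy0 : t 0 - 1%:M = homotopy 0 *m dif R 0.
Proof.
apply: (epsilon_spec (inhabits 0) homotopies0); apply: mx_factor => a.
by apply/(exact_0 resR); rewrite -row_mul mulmxBl t0 mul1mx subrr row0.
Qed.

Lemma homotopyS i :
  t i.+1 - 1%:M - dif R i *m homotopy i = homotopy i.+1 *m dif R i.+1.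
Proof.
elim: i => [|i IH]; apply: (epsilon_spec (inhabits 0) (homotopiesS (homotopy _)));
  apply: mx_factor => a; apply/(exact_S resR);
  rewrite -row_mul mulmxBl -[in X in _ - X]mulmxA.
  by rewrite -homotopy0 mulmxBl tS mulmxBr mul1mx mulmx1 subrr row0.
rewrite -IH mulmxBl tS mul1mx !mulmxBr mulmxA mulmx1 (dif_dif _ resR) mul0mx.
by rewrite subr0 subrr row0.
Qed.

End Homotopy.

(** * Independence of Tor from the resolution *)

Definition tor_cycle F i : 'rV[k]_(rk F i) -> Prop :=
  match i with
  | 0 => fun=> True
  | i'.+1 => fun z => z *m dif_k F i' = 0
  end.

(** An elementwise form of [tor_dim F i j = 0]. The preimage [w] may have components of any degree;
    [dif_k_strand] cuts it down to degree [j]. *)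
Definition tor_vanishes F i j : Prop :=
  forall z : 'rV[k]_(rk F i), (forall a, dg a <> j -> z 0 a = 0) -> tor_cycle z ->
    exists w, z = w *m dif_k F i.

Lemma sub_strand F i j (z : 'rV[k]_(rk F i)) :
  (z <= strand F i j)%MS <-> forall a, dg a <> j -> z 0 a = 0.
Proof.
split=> [/submxP[w ->] a|H].
  by move=> /eqP/negPf ne; rewrite mul_mx_diag !mxE ne mulr0.
apply/submxP; exists z; rewrite mul_mx_diag; apply/rowP => a; rewrite !mxE.
by case: eqP => [|/H->]; rewrite ?mulr1 ?mul0r.
Qed.

Lemma dif_k_degree I F i a b : graded_free_resolution F I ->
  dif_k F i a b != 0 -> dg a = dg b.
Proof.
by move=> res; rewrite mxE -mcoeff_msupp => /(dif_homog res); rewrite mdeg0 add0r.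
Qed.

Lemma dif_k_strand I F i j (w : 'rV_(rk F i.+1)) : graded_free_resolution F I ->
  (forall a, dg a <> j -> (w *m dif_k F i) 0 a = 0) ->
  w *m dif_k F i = w *m strand F i.+1 j *m dif_k F i.
Proof.
move=> res H; apply/rowP => b; rewrite mul_mx_diag !mxE.
have [bj|nbj] := eqVneq (dg b) j; last first.
  have := H b (elimN eqP nbj); rewrite mxE => ->; apply/esym/big1 => a _; rewrite !mxE.
  have [aj|_] := eqVneq (dg a) j; last by rewrite mulr0 mul0r.
  have [e0|/(dif_k_degree res) e] := eqVneq (dif_k F i a b) 0.
    by move: e0; rewrite mxE => ->; rewrite mulr0.
  by rewrite -e aj eqxx in nbj.
apply: eq_bigr => a _; rewrite !mxE.
have [e0|/(dif_k_degree res) e] := eqVneq (dif_k F i a b) 0.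
  by move: e0; rewrite mxE => ->; rewrite !mulr0.
by rewrite e bj eqxx mulr1.
Qed.

Lemma dif_k_dif_k I F i : graded_free_resolution F I -> dif_k F i.+1 *m dif_k F i = 0.
Proof. by move=> res; rewrite -map_mxM (dif_dif _ res) map_mx0. Qed.

Lemma sub_tor_cycles F i j (z : 'rV[k]_(rk F i)) :
  (z <= tor_cycles F i j)%MS <-> (forall a, dg a <> j -> z 0 a = 0) /\ tor_cycle z.
Proof.
case: i z => [|i] z /=; first by rewrite sub_strand; split=> [|[]].
rewrite sub_capmx; split=> [/andP[/sub_strand H /sub_kermxP]|[H Hk]] //.
by apply/andP; split; [apply/sub_strand | apply/sub_kermxP].
Qed.

(** The truncated subtraction in [tor_dim] vanishes iff the rank of the cycles is at most that of
    the boundaries. As boundaries are cycles, the two spaces then coincide. *)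
Lemma tor_dim_eq0 I F i j : graded_free_resolution F I ->
  tor_dim F i j = 0%N <-> tor_vanishes F i j.
Proof.
move=> res.
have BC : (tor_boundaries F i j <= tor_cycles F i j)%MS.
  apply/row_subP => a; apply/sub_tor_cycles; split; last first.
    by case: i a => [|i] a //=; rewrite -row_mul -mulmxA (dif_k_dif_k _ res) mulmx0 row0.
  move=> b nbj; rewrite mxE /tor_boundaries /strand mul_diag_mx !mxE.
  case: eqP => [aj|_]; last by rewrite mul0r.
  rewrite mul1r; apply/eqP/negPn/negP => nz; case: nbj; rewrite -aj.
  by apply/esym/(dif_k_degree res); rewrite mxE.
transitivity (tor_cycles F i j <= tor_boundaries F i j)%MS.
  rewrite /tor_dim; have := mxrank_leqif_sup BC => -[le <-].
  by rewrite eqn_leq le -subn_eq0; split=> /eqP.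
split=> [/row_subP sub z Hz cz|tv].
  have /submxP[w ->] : (z <= tor_boundaries F i j)%MS.
    apply: submx_trans (introT row_subP sub) => //.
    exact/sub_tor_cycles.
  by exists (w *m strand F i.+1 j); rewrite -mulmxA.
apply/row_subP => a.
have /sub_tor_cycles[Hz cz] := row_sub a (tor_cycles F i j).
have [w wE] := tv _ Hz cz.
rewrite wE (dif_k_strand (j := j) res) -?wE // -mulmxA.
exact: submxMl.
Qed.

(** A cycle over [R] is sent to [F], filled there, and the filling is sent back. The homotopy
    between the round trip and the identity corrects the result. *)
Lemma tor_vanishes_invariant I F R i j :
  graded_free_resolution F I -> graded_free_resolution R I ->
  tor_vanishes F i j -> tor_vanishes R i j.
Proof.
move=> resF resR tv z Hz cz.
pose f l := lift_map R F l; pose g l := lift_map F R l; pose t l := f l *m g l.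
have [f0 _] := lift_map0 resR resF; have [g0 _] := lift_map0 resF resR.
have fS l := (lift_mapS resR resF l).1; have gS l := (lift_mapS resF resR l).1.
have t0 : t 0%N *m aug R = aug R by rewrite -mulmxA -g0 -f0.
have tS l : t l.+1 *m dif R l = dif R l *m t l.
  by rewrite -mulmxA -gS mulmxA -fS mulmxA.
have [w wE] : exists w, z *m map_mx (mcoeff 0%MM) (f i) = w *m dif_k F i.
  apply: tv.
    move=> b nbj; rewrite mxE big1 // => a _.
    have [aj|/eqP naj] := eqVneq (dg a) j; last by rewrite Hz ?mul0r.
    rewrite mxE; apply/eqP; rewrite mulf_eq0; apply/orP; right.
    rewrite mcoeff_eq0; apply/negP => /(lift_map_homog resR resF).
    by rewrite mdeg0 aj => /esym/eqP; rewrite subr_eq0 => /eqP e; case: nbj.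
  case: (i) z cz {Hz} => //= l z cz.
  by rewrite -mulmxA -map_mxM -fS map_mxM mulmxA cz mul0mx.
have {}wE : z *m map_mx (mcoeff 0%MM) (t i) =
    w *m map_mx (mcoeff 0%MM) (g i.+1) *m dif_k R i.
  by rewrite map_mxM mulmxA wE -!mulmxA -!map_mxM gS.
have hE : z *m map_mx (mcoeff 0%MM) (homotopy t i) *m dif_k R i =
    z *m map_mx (mcoeff 0%MM) (t i) - z.
  case: (i) z cz {Hz w wE} => [|l] z cz; rewrite -mulmxA -map_mxM.
    by rewrite -(homotopy0 resR t0) map_mxB map_mx1 mulmxBr mulmx1.
  have {}cz : z *m map_mx (mcoeff 0%MM) (dif R l) = 0 := cz.
  rewrite -(homotopyS resR t0 tS) !map_mxB map_mx1 !mulmxBr mulmx1.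
  by rewrite [map_mx _ (dif R l *m _)]map_mxM [z *m (_ *m _)]mulmxA cz mul0mx subr0.
exists (w *m map_mx (mcoeff 0%MM) (g i.+1) - z *m map_mx (mcoeff 0%MM) (homotopy t i)).
by rewrite mulmxBl -wE hE opprB addrC subrK.
Qed.

(** [betti] uses an unspecified resolution; [R] shows that one exists, and invariance transfers
    vanishing between the two. *)
Lemma betti_eq0 I R i j : graded_free_resolution R I ->
  betti I i j = 0%N <-> tor_vanishes R i j.
Proof.
move=> resR.
have [F resF ->] : exists2 F, graded_free_resolution F I & betti I i j = tor_dim F i j.
  by apply: (epsilon_spec (inhabits 0%N)
    (fun b => exists2 F, graded_free_resolution F I & b = tor_dim F i j));
    exists (tor_dim R i j), R.
rewrite (tor_dim_eq0 _ _ resF); split=> [tvF|tvR].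
  exact: (tor_vanishes_invariant resF resR tvF).
exact: (tor_vanishes_invariant resR resF tvR).
Qed.

End Comparison.

(** * The resolution supported on the lcm-lattice *)

Lemma lepm_anti n (m m' : 'X_{1..n}) : (m <= m')%MM -> (m' <= m)%MM -> m = m'.
Proof.
move=> /mnm_lepP le /mnm_lepP ge; apply/mnmP => i.
by apply/eqP; rewrite eqn_leq le ge.
Qed.

Lemma lem_mdeg n (m m' : 'X_{1..n}) : (m <= m')%MM -> (mdeg m <= mdeg m')%N.
Proof. by move=> le; rewrite -(submK le) mdegD leq_addl. Qed.

Lemma lem_mdeg_eq n (m m' : 'X_{1..n}) :
  (m <= m')%MM -> (mdeg m' <= mdeg m)%N -> m = m'.
Proof.
move=> le ge; have e := submK le; rewrite -e mdegD in ge.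
have /eqP : mdeg (m' - m)%MM = 0%N by lia.
by rewrite mdeg_eq0 => /eqP e0; rewrite -e e0 add0m.
Qed.

Lemma big_mlcm_le n (J : Type) (s : seq J) (Q : pred J) (f : J -> 'X_{1..n}) m :
  (\big[@mlcm n/0%MM]_(a <- s | Q a) f a <= m)%MM = all (fun a => Q a ==> (f a <= m)%MM) s.
Proof.
elim: s => [|a s IH] /=; first by rewrite big_nil; apply/mnm_lepP => i; rewrite mnmE.
by rewrite big_cons; case: (Q a); rewrite ?lem_mlcm IH.
Qed.

Section Lattice.
Variables (k : fieldType) (n : nat) (I : {mpoly k[n]} -> Prop).
Hypothesis hI : monomial_ideal I.
Local Notation V := (lcm_lattice I).
Local Notation le := (@lcm_le k n I).
Implicit Types (u v w p : V) (F : {set V}) (m : 'X_{1..n}).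

Lemma lcm_le_refl : reflexive le.
Proof. by move=> v; apply: lepm_refl. Qed.

Lemma lcm_le_anti : antisymmetric le.
Proof. by move=> v w /andP[vw wv]; apply: val_inj; apply: lepm_anti. Qed.

Lemma lcm_le_trans : transitive le.
Proof. by move=> v w u; apply: lepm_trans. Qed.

Lemma lcm_of_gens (Q : pred 'X_{1..n}) :
  exists v, forall m, (val v <= m)%MM <-> forall g, g \in mingens I -> Q g -> (g <= m)%MM.
Proof.
pose A := [fset g in mingens I | Q g]%fset.
have AL : \big[@mlcm n/0%MM]_(g <- A) g \in lcm_set I.
  apply/imfsetP; exists A => //=; rewrite fpowersetE.
  by apply/fsubsetP => g; rewrite !inE => /andP[].
exists [` AL]%fset => m /=; rewrite big_mlcm_le; split=> [/allP H g gG Qg|H].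
  by apply: H; rewrite !inE gG.
by apply/allP => g; rewrite !inE => /andP[gG Qg]; apply: H.
Qed.

(** Every lattice element is the lcm of all the generators dividing it. *)
Lemma lcm_leP v m :
  (val v <= m)%MM <-> forall g, g \in mingens I -> (g <= val v)%MM -> (g <= m)%MM.
Proof.
split=> [le_vm g _ /lepm_trans->//|H].
have [A AG vE] : exists2 A, A \in fpowerset (mingens I) &
    val v = \big[@mlcm n/0%MM]_(g <- (A : {fset _})) g.
  by have /imfsetP[A AG vE] := valP v; exists A.
rewrite vE big_mlcm_le; apply/allP => g gA /=; apply: H.
  by move: AG; rewrite fpowersetE => /fsubsetP; apply.
have := lepm_refl (val v); rewrite {1}vE big_mlcm_le => /allP; exact.
Qed.

Lemma lcm_join v w : exists u, val u = mlcm (val v) (val w).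
Proof.
have [u uP] := lcm_of_gens (fun g => (g <= val v)%MM || (g <= val w)%MM).
exists u; apply: lepm_anti.
  apply/uP => g _ /orP[] h; apply: lepm_trans h _.
    exact: lem_mlcml.
  exact: lem_mlcmr.
have /uP H := lepm_refl (val u); rewrite lem_mlcm.
by apply/andP; split; apply/lcm_leP => g gG gv; apply: H; rewrite ?gv ?orbT.
Qed.

Lemma lcm_gen g : g \in mingens I -> exists v, val v = g.
Proof.
move=> gG; have [v vP] := lcm_of_gens (pred1 g).
exists v; apply: lepm_anti; first by apply/vP => h _ /eqP->; apply: lepm_refl.
by have /vP := lepm_refl (val v); apply => //=.
Qed.

Lemma mingens_antichain g h : g \in mingens I -> h \in mingens I -> (g <= h)%MM -> g = h.
Proof.
move=> gG hG le_gh; apply/eqP/negPn/negP => neq.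
have [gen min] := mingensP hI.
apply: (min (mingens I `\ h)%fset); first by rewrite fproperD1.
move=> f; rewrite (gen f); split; apply: mon_ideal_sub => m.
  move=> mG; have [->|nm] := eqVneq m h.
    by exists g; rewrite // !inE neq.
  by exists m; rewrite ?lepm_refl // !inE nm.
by rewrite !inE => /andP[_ mG]; exists m; rewrite ?lepm_refl.
Qed.

(* The elements of the lattice lying in [I]: all of them but the minimum,
   except that for the unit ideal they form the whole lattice {1}. *)
Definition posL : {set V} := [set v | has (fun g => (g <= val v)%MM) (mingens I)].

Lemma posLP v : reflect (exists2 g, g \in mingens I & (g <= val v)%MM) (v \in posL).
Proof. by rewrite inE; apply: hasP. Qed.

Lemma posL_up v w : v \in posL -> le v w -> w \in posL.
Proof. by case/posLP => g gG gv vw; apply/posLP; exists g => //; apply: lepm_trans vw. Qed.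

Lemma notin_posL v : v \notin posL -> val v = 0%MM.
Proof.
move=> vP; apply: lepm_anti; last by apply/mnm_lepP => i; rewrite mnmE.
apply/lcm_leP => g gG gv; case/negP: vP; apply/posLP; by exists g.
Qed.

Definition below m : {set V} := [set v in posL | (val v <= m)%MM].

Lemma below_top m : below m != set0 ->
  exists2 t, t \in below m & forall v, v \in below m -> le v t.
Proof.
case/set0Pn => p; rewrite inE => /andP[/posLP[g gG gp] pm].
have [t tP] := lcm_of_gens (fun g => (g <= m)%MM).
have tm : (val t <= m)%MM by apply/tP.
have /tP t_ub := lepm_refl (val t).
exists t.
  rewrite inE tm andbT; apply/posLP; exists g => //.
  by apply: t_ub => //; apply: lepm_trans pm.
move=> v; rewrite inE => /andP[_ vm]; apply/lcm_leP => h hG hv.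
by apply: t_ub => //; apply: lepm_trans vm.
Qed.

(** The lcm of all generators dividing [m] is an apex. This is the source of exactness of the
    resolution in multidegree [m]. *)
Lemma acyclic_below m c : below m != set0 -> acyclic_at k le (below m) c.
Proof.
case/below_top => t tB ub; apply: (acyclic_cone lcm_le_refl tB) => v vB.
by rewrite /comparable ub.
Qed.

(** For a nonempty chain this is its maximum, by [lab_max]; as an lcm it is defined and monotone on
    all sets. *)
Definition lab F : 'X_{1..n} := \big[@mlcm n/0%MM]_(v in F) val v.

Lemma lab_leP F m : reflect (forall v, v \in F -> (val v <= m)%MM) (lab F <= m)%MM.
Proof.
rewrite /lab big_mlcm_le; apply: (iffP allP) => H v.
  by move=> vF; apply: (implyP (H v (mem_index_enum v))).
by move=> _; apply/implyP; apply: H.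
Qed.

Lemma labS F F' : F \subset F' -> (lab F <= lab F')%MM.
Proof.
by move/subsetP=> sub; apply/lab_leP => v /sub; apply/lab_leP; apply: lepm_refl.
Qed.

Lemma lab_max F v : v \in F -> (forall w, w \in F -> le w v) -> lab F = val v.
Proof.
move=> vF ub; apply: lepm_anti; first exact/lab_leP.
by move: v vF {ub}; apply/lab_leP; apply: lepm_refl.
Qed.

Lemma lab_set1 v : lab [set v] = val v.
Proof. by apply: lab_max => [|w /set1P->]; rewrite ?set11 ?lcm_le_refl. Qed.

Lemma lab_set0 : lab set0 = 0%MM.
Proof. by rewrite /lab big_set0. Qed.

Lemma chain_max F : chain le F -> F != set0 ->
  exists2 v, v \in F & forall w, w \in F -> le w v.
Proof.
move=> chF /set0Pn[v0 v0F].
pose v := [arg max_(v > v0 in F) mdeg (val v)].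
have [vF vmax] : v \in F /\ forall w, w \in F -> (mdeg (val w) <= mdeg (val v))%N.
  by rewrite /v; case: arg_maxnP => // w wF H; split.
exists v => // w wF; have /orP[//|] := chainP _ _ chF w v wF vF.
by move=> vw; rewrite (val_inj (lem_mdeg_eq vw (vmax w wF))) lcm_le_refl.
Qed.

Definition faces c : {set {set V}} :=
  [set F | [&& chain le F, F \subset posL & #|F| == c]].

Lemma facesP F c :
  reflect [/\ chain le F, F \subset posL & #|F| = c] (F \in faces c).
Proof.
rewrite inE; apply: (iffP and3P) => [[? ? /eqP]|[? ? /eqP]]; by split.
Qed.

Lemma facesU1 v F c : v \notin F -> v |: F \in faces c.+1 -> F \in faces c.
Proof.
move=> vF /facesP[/(chainU1 (@lcm_le_refl)) [chF _] sub card]; apply/facesP.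
split=> //; first by apply: subset_trans sub; apply: subsetUr.
by move: card; rewrite cardsU1 vF => -[].
Qed.

Section Extension.
Variables (X : zmodType) (c : nat).

(** Extension by zero of a vector of coefficients to all sets; the sum has at most one term. *)
Definition ext (x : 'rV[X]_#|faces c|) F : X :=
  \sum_(a | enum_val a == F) x 0 a.

Lemma ext_enum_val x a : ext x (enum_val a) = x 0 a.
Proof. by rewrite /ext (big_pred1 a) // => b; apply/eqP/eqP => [/enum_val_inj|->]. Qed.

Lemma ext_out x F : F \notin faces c -> ext x F = 0.
Proof.
move=> nF; rewrite /ext big_pred0 // => a; apply/eqP => aF.
by rewrite -aF enum_valP in nF.
Qed.

Lemma ext_row (f : {set V} -> X) F :
  (forall F', F' \notin faces c -> f F' = 0) -> ext (\row_a f (enum_val a)) F = f F.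
Proof.
move=> f0; have [FF|nF] := boolP (F \in faces c); last by rewrite ext_out ?f0.
by rewrite -(enum_rankK_in FF FF) ext_enum_val mxE.
Qed.

Lemma face_enum F : F \in faces c -> exists a : 'I_#|faces c|, F = enum_val a.
Proof. by move=> FF; exists (enum_rank_in FF F); rewrite enum_rankK_in. Qed.

End Extension.

(** * The resolution on labelled chains and its multigraded parts *)

Local Notation S := {mpoly k[n]}.
Local Notation inc := (@incidence k V).

(** The sum has at most one term: the signed quotient of the labels if [F'] is a facet of [F]. With
    [F'] empty it gives the augmentation. *)
Definition bd F F' : S :=
  \sum_(v | (v \notin F') && (v |: F' == F)) inc v F' *: 'X_[lab F - lab F'].

Definition lcm_resolution : free_seq k n := {|
  rk := fun i => #|faces i.+1|;
  dg := fun i a => (mdeg (lab (enum_val a)))%:Z;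
  dif := fun i => \matrix_(a, b) bd (enum_val a) (enum_val b);
  aug := \col_a bd (enum_val a) set0 |}.
Local Notation R := lcm_resolution.

Lemma ext_bd c (x : 'rV[S]_#|faces c|) F :
  \sum_a x 0 a * bd (enum_val a) F =
  \sum_(v | v \notin F) inc v F *: (ext x (v |: F) * 'X_[lab (v |: F) - lab F]).
Proof.
under eq_bigr do rewrite /bd mulr_sumr.
rewrite (exchange_big_dep (fun v => v \notin F)) /=; last by move=> a v _ /andP[].
apply: eq_bigr => v vF; rewrite /ext mulr_suml scaler_sumr.
apply: eq_big => [a|a /andP[_ /eqP->]]; first by rewrite vF eq_sym.
by rewrite scalerAr.
Qed.

(* The part of multidegree [m] of an element of the free module on the faces. *)
Definition multicomp c m (x : 'rV[S]_#|faces c|) : {ffun {set V} -> k} :=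
  [ffun F : {set V} => if (lab F <= m)%MM then (ext x F)@_(m - lab F) else 0].

Lemma mcoeff_mulX (p : S) (m u : 'X_{1..n}) :
  (p * 'X_[u])@_m = if (u <= m)%MM then p@_(m - u) else 0.
Proof.
case: ifP => [um|num]; first by rewrite -{1}(submK um) addmC mcoeffMX.
apply/eqP; rewrite mcoeff_eq0; apply/negP => /msuppM_le/allpairsP[[a b] /= [_]].
by rewrite msuppX inE => /eqP-> mE; rewrite mE lem_addl in num.
Qed.

Lemma subm_mdeg_shift (a b m : 'X_{1..n}) : (a <= b)%MM -> (a <= m)%MM ->
  ((b - a <= m - a) = (b <= m))%MM /\ (m - a - (b - a) = m - b)%MM.
Proof.
move=> /mnm_lepP ab /mnm_lepP am; split.
  by apply/mnm_lepP/mnm_lepP => H i; move: (H i) (ab i) (am i); rewrite !mnmBE; lia.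
by apply/mnmP => i; move: (ab i) (am i); rewrite !mnmBE; lia.
Qed.

Lemma mcoeff_bd_sum c m (x : 'rV[S]_#|faces c|) F : (lab F <= m)%MM ->
  (\sum_a x 0 a * bd (enum_val a) F)@_(m - lab F) = boundary (multicomp m x) F.
Proof.
move=> Fm; rewrite ext_bd raddf_sum boundaryE /=; apply: eq_bigr => v vF.
have le_lab := labS (subsetUr [set v] F).
have [e1 e2] := subm_mdeg_shift le_lab Fm.
by rewrite mcoeffZ mcoeff_mulX ffunE e1 e2.
Qed.

(** In multidegree [m] the differential becomes the simplicial boundary on the chains of
    [below m]. *)
Lemma multicomp_dif i m (x : 'rV_(rk R i.+1)) :
  multicomp m (x *m dif R i) = boundary (multicomp m x).
Proof.
apply/ffunP => F; rewrite [LHS]ffunE.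
have [FF|nF] := boolP (F \in faces i.+1); last first.
  rewrite ext_out // mcoeff0 if_same boundaryE big1 // => v vF.
  rewrite ffunE ext_out ?mcoeff0 ?if_same ?mulr0 //.
  by apply: contra nF; apply: facesU1.
have [Fm|nFm] := boolP (lab F <= m)%MM; last first.
  rewrite boundaryE big1 // => v vF; rewrite ffunE ifF ?mulr0 //.
  by apply: contraNF nFm; apply: lepm_trans; apply: labS; apply: subsetUr.
rewrite -mcoeff_bd_sum //; congr mcoeff.
have [b ->] := face_enum FF; rewrite ext_enum_val mxE.
by apply: eq_bigr => a _; rewrite mxE.
Qed.

Lemma mcoeff_aug m (x : 'rV_(rk R 0)) :
  ((x *m aug R) 0 0)@_m = boundary (multicomp m x) set0.
Proof.
rewrite -mcoeff_bd_sum; last by rewrite lab_set0; apply/mnm_lepP => i; rewrite mnmE.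
rewrite lab_set0 subm0 mxE; congr mcoeff.
by apply: eq_bigr => a _; rewrite mxE.
Qed.

Lemma multicomp_inj c (x y : 'rV[S]_#|faces c|) :
  (forall m, multicomp m x = multicomp m y) -> x = y.
Proof.
move=> H; apply/rowP => a; apply/mpolyP => u.
have /ffunP/(_ (enum_val a)) := H (u + lab (enum_val a))%MM.
by rewrite !ffunE lem_addl addmK !ext_enum_val.
Qed.

Lemma multicomp_supported c m (x : 'rV[S]_#|faces c|) :
  supported le (below m) c (multicomp m x).
Proof.
move=> F; rewrite ffunE; case: ifP => [Fm|_]; last by rewrite eqxx.
have [/facesP[chF sub card] _|nF] := boolP (F \in faces c); last by rewrite ext_out ?mcoeff0 ?eqxx.
split=> //; apply/subsetP => v vF; rewrite inE (subsetP sub) //=.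
by move: v vF; apply/lab_leP.
Qed.

Lemma multicomp_finite c (x : 'rV[S]_#|faces c|) :
  exists M : seq 'X_{1..n}, forall m, multicomp m x != 0 -> m \in M.
Proof.
exists [seq (e + lab (enum_val a))%MM | a <- enum 'I_#|faces c|, e <- msupp (x 0 a)].
move=> m nz; have [F nzF] : exists F, multicomp m x F != 0.
  apply/existsP; apply: contraNT nz => /existsPn H; apply/eqP/ffunP => F.
  by rewrite [RHS]ffunE; apply/eqP; rewrite -[_ == _]negbK H.
move: nzF; rewrite ffunE; case: ifP => [Fm|]; last by rewrite eqxx.
have [FF|nF] := boolP (F \in faces c); last by rewrite ext_out ?mcoeff0 ?eqxx.
have [a aE] := face_enum FF; rewrite {}aE in Fm *; rewrite ext_enum_val -mcoeff_msupp => nz'.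
apply/allpairsPdep; exists a, (m - lab (enum_val a))%MM.
by rewrite mem_enum submK.
Qed.

(** The value of [Z m] at a face is placed on the monomial [m - lab]; finiteness of [M] makes the
    coefficients polynomials. *)
Lemma multicomp_onto c (Z : 'X_{1..n} -> {ffun {set V} -> k}) (M : seq 'X_{1..n}) :
  (forall m, supported le (below m) c (Z m)) -> (forall m, Z m != 0 -> m \in M) ->
  exists x : 'rV[S]_#|faces c|, forall m, multicomp m x = Z m.
Proof.
move=> HZ ZM.
exists (\row_a \sum_(m <- undup M | (lab (enum_val a) <= m)%MM)
   Z m (enum_val a) *: 'X_[m - lab (enum_val a)]) => m.
apply/ffunP => F; rewrite ffunE.
have [FF|nF] := boolP (F \in faces c); last first.
  rewrite ext_out // mcoeff0 if_same; apply/esym/eqP; apply: contraNT nF.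
  move=> /HZ[chF sub card]; apply/facesP; split=> //.
  by apply/subsetP => v /(subsetP sub); rewrite inE => /andP[].
have [a ->] := face_enum FF; rewrite ext_enum_val mxE.
move: (enum_val a) => G; case: ifP => [Gm|nGm]; last first.
  apply/esym/eqP; apply: contraFT nGm => /HZ[_ sub _]; apply/lab_leP => v /(subsetP sub).
  by rewrite inE => /andP[].
rewrite raddf_sum /=.
have coef m' : (lab G <= m')%MM ->
    (Z m' G *: 'X_[m' - lab G])@_(m - lab G) = if m' == m then Z m G else 0.
  move=> Gm'; rewrite mcoeffZ mcoeffX; case: (eqVneq m' m) => [->|neq].
    by rewrite eqxx mulr1.
  case: eqP => [e|]; last by rewrite mulr0.
  by move: neq; rewrite -(submK Gm') e submK ?eqxx.
rewrite (eq_bigr _ coef) -big_mkcondr /=.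
have [mM|mM] := boolP (m \in M); last first.
  rewrite [Z m](_ : _ = 0) ?ffunE; last by apply/eqP; apply: contraNT mM; apply: ZM.
  by rewrite big1.
rewrite -big_filter (_ : [seq m' <- undup M | (lab G <= m')%MM && (m' == m)] = [:: m]) ?big_seq1 //.
rewrite (eq_filter (a2 := pred1 m)); last by move=> m' /=; case: eqP => [->|]; rewrite ?Gm ?andbF.
by rewrite filter_pred1_uniq ?undup_uniq ?mem_undup.
Qed.

Lemma multicomp_exact i (x : 'rV_(rk R i)) :
  (exists y, x = y *m dif R i) <-> forall m, boundary (multicomp m x) = 0.
Proof.
split=> [[y ->] m|bx]; first by rewrite multicomp_dif boundary_boundary.
(* Filling zero by zero keeps the family of fillings finitely supported, as [multicomp_onto]
   requires. *)
pose fills m (y : {ffun {set V} -> k}) := [/\ supported le (below m) i.+2 y,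
  boundary y = multicomp m x & multicomp m x = 0 -> y = 0].
have fill m : exists y, fills m y.
  have [e|nz] := eqVneq (multicomp m x) 0.
    by exists 0; rewrite /fills e; split; [apply: supported0 | rewrite raddf0 |].
  (* If [below m] were empty, it would carry no face with [i + 1] vertices, and the cycle would be
     zero. *)
  have [|y Hy bxy] := acyclic_below _ (multicomp_supported (x := x)) (bx m).
    apply: contraNneq nz => B0; apply/eqP/ffunP => F; rewrite [RHS]ffunE.
    apply/eqP/negPn/negP => /multicomp_supported[_]; rewrite B0 subset0 => /eqP->.
    by rewrite cards0.
  by exists y; split=> // e0; rewrite e0 eqxx in nz.
pose Z m := epsilon (inhabits 0) (fills m).
have ZP m : fills m (Z m) by apply: epsilon_spec (fill m).
have [M MP] := multicomp_finite x.
have [|m nz|y yE] := @multicomp_onto i.+2 Z M.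
- by move=> m; have [] := ZP m.
- apply: MP; apply: contraNneq nz => e0; apply/eqP.
  by have [_ _ ->] := ZP m.
exists y; apply: multicomp_inj => m; rewrite multicomp_dif yE.
by have [_ ->] := ZP m.
Qed.

Lemma bd_homog F F' (m : 'X_{1..n}) :
  m \in msupp (bd F F') -> (mdeg m + mdeg (lab F') = mdeg (lab F))%N.
Proof.
rewrite mcoeff_msupp raddf_sum /= => nz.
have [v /andP[vF /eqP FE] ] : exists2 v, (v \notin F') && (v |: F' == F) &
    m = (lab F - lab F')%MM.
  have [/existsP[v /andP[Qv nzv]]|/existsPn H] :=
    boolP [exists v, ((v \notin F') && (v |: F' == F)) && (m == (lab F - lab F')%MM)].
    by exists v => //; apply/eqP.
  case/eqP: nz; apply: big1 => v Qv; rewrite mcoeffZ mcoeffX eq_sym.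
  by have := H v; rewrite Qv /= => /negPf->; rewrite mulr0.
by move=> ->; rewrite -mdegD submK // -FE; apply: labS; apply: subsetUr.
Qed.

Lemma boundary_at_set0 m (x : 'rV_(rk R 0)) :
  boundary (multicomp m x) = 0 <-> boundary (multicomp m x) set0 = 0.
Proof.
split=> [->|b0]; first by rewrite ffunE.
apply/ffunP => F; rewrite [RHS]ffunE; apply/eqP/negPn/negP => nz.
have [_ _ /cards0_eq F0] := supported_boundary (multicomp_supported (x := x)) nz.
by rewrite F0 b0 eqxx in nz.
Qed.

Lemma bd_set1 v : bd [set v] set0 = 'X_[val v].
Proof.
rewrite /bd (big_pred1 v) => [|w]; last by rewrite inE setU0 /= (inj_eq set1_inj).
rewrite /incidence [X in _ ^+ X](_ : _ = 0%N) ?scale1r.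
  by rewrite lab_set1 lab_set0 subm0.
by apply/eqP; rewrite cards_eq0; apply/eqP/setP => u; rewrite !inE.
Qed.

Lemma faces1P F : reflect (exists2 v, v \in posL & F = [set v]) (F \in faces 1).
Proof.
apply: (iffP (facesP _ _)) => [[_ sub /eqP/cards1P[v Fv]]|[v vP ->]].
  by exists v => //; rewrite -sub1set -Fv.
rewrite cards1 sub1set; split=> //; apply/chainP => a b.
by rewrite !inE => /eqP-> /eqP->; rewrite /comparable lcm_le_refl.
Qed.

Lemma lcm_resolution_onto f : I f <-> exists x : 'rV_(rk R 0), f = (x *m aug R) 0 0.
Proof.
have [gen _] := mingensP hI; rewrite (gen f); split=> [[s [sG ->]]|[x ->]].
  elim: s sG => [|t s IH] sG.
    by exists 0; rewrite big_nil mul0mx mxE.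
  rewrite big_cons; have [|x ->] := IH; first by move=> u us; apply: sG; rewrite inE us orbT.
  have tG := sG t (mem_head _ _); have [v vE] := lcm_gen tG.
  have /faces1P/face_enum[a aE] : exists2 w, w \in posL & [set v] = [set w].
    by exists v => //; apply/posLP; exists t.2 => //; rewrite vE lepm_refl.
  exists (t.1 *: delta_mx 0 a + x).
  by rewrite mulmxDl -scalemxAl -rowE !mxE -aE bd_set1 vE.
apply: (mon_ideal_sub (M := fun m => exists2 v, v \in posL & val v = m)).
  by move=> m [v /posLP[g gG gv] <-]; exists g.
exists [seq (x 0 a, lab (enum_val a)) | a <- enum 'I_(rk R 0)]; split.
  move=> _ /mapP[a _ ->] /=; have /faces1P[v vP ->] := enum_valP a.
  by exists v; rewrite // lab_set1.
rewrite big_map mxE big_enum /=; apply: eq_bigr => a _; rewrite mxE.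
by have /faces1P[v _ ->] := enum_valP a; rewrite bd_set1 lab_set1.
Qed.

Lemma lcm_resolutionP : graded_free_resolution R I.
Proof.
split.
- by move=> i a b m; rewrite mxE => /bd_homog e; rewrite /= -e PoszD.
- by move=> a m; rewrite mxE => /bd_homog e; rewrite /= -e lab_set0 mdeg0 addn0.
- exact: lcm_resolution_onto.
- move=> x; rewrite multicomp_exact; split=> [x0 m|bx].
    by apply/boundary_at_set0; rewrite -mcoeff_aug x0 mxE mcoeff0.
  apply/rowP => a; rewrite ord1 [RHS]mxE; apply/mpolyP => m.
  by rewrite mcoeff_aug bx ffunE mcoeff0.
move=> i x; rewrite multicomp_exact; split=> [x0 m|bx].
  rewrite -multicomp_dif x0; apply/ffunP => F; rewrite !ffunE.
  by rewrite /ext big1 ?mcoeff0 ?if_same // => a _; rewrite mxE.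
apply: multicomp_inj => m; rewrite multicomp_dif bx.
apply/ffunP => F; rewrite !ffunE.
by rewrite /ext big1 ?mcoeff0 ?if_same // => a _; rewrite mxE.
Qed.

(** * Tor as the homology of open lower intervals *)

Definition below_strict v : {set V} := [set w in posL | (w != v) && le w v].

(* The differential of the resolution tensored with [k] only keeps the faces
   with the same label. *)
Definition tor_boundary (y : {ffun {set V} -> k}) : {ffun {set V} -> k} :=
  [ffun F : {set V} => \sum_(v | v \notin F)
     inc v F * (if lab (v |: F) == lab F then y (v |: F) else 0)].

Lemma tor_boundary_is_zmod_morphism : zmod_morphism tor_boundary.
Proof.
move=> x y; apply/ffunP => F; rewrite !ffunE -sumrB; apply: eq_bigr => v _.
by rewrite !ffunE; case: ifP; rewrite ?subr0 -mulrBr // subrr.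
Qed.
HB.instance Definition _ := GRing.isZmodMorphism.Build
  {ffun {set V} -> k} {ffun {set V} -> k} tor_boundary tor_boundary_is_zmod_morphism.

Lemma dif_k_lcm_resolution i (z : 'rV[k]_(rk R i.+1)) b :
  (z *m dif_k R i) 0 b = tor_boundary [ffun F => ext z F] (enum_val b).
Proof.
pose x := map_mx (@mpolyC n k) z.
transitivity ((\sum_a x 0 a * bd (enum_val a) (enum_val b))@_0).
  rewrite raddf_sum mxE; apply: eq_bigr => a _; rewrite !mxE /=.
  by rewrite mcoeffCM.
rewrite ext_bd raddf_sum ffunE /=; apply: eq_bigr => v vF.
have extx F : ext x F = (ext z F)%:MP.
  by rewrite /ext raddf_sum; apply: eq_bigr => a _; rewrite mxE.
rewrite mcoeffZ extx mcoeffCM mcoeffX ffunE; congr (_ * _).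
move: (enum_val b) vF => F vF.
have le_lab := labS (subsetUr [set v] F).
case: eqVneq => [e|ne]; case: eqVneq => [e'|ne']; rewrite ?mulr1 ?mulr0 //.
  by case/eqP: ne'; rewrite -(submK le_lab) e add0m.
by case/eqP: ne; rewrite e'; apply/mnmP => l; rewrite mnmBE subnn mnmE.
Qed.

Lemma face_lab F v c : F \in faces c.+1 -> lab F = val v ->
  [/\ v \in F, v \in posL & F :\ v \subset below_strict v].
Proof.
move=> /facesP[chF sub card] labF.
have [|t tF ub] := chain_max chF; first by rewrite -card_gt0 card.
have tv : t = v by apply: val_inj; rewrite -labF (lab_max tF ub).
rewrite -tv; split=> //; first exact: (subsetP sub).
apply/subsetP => w; rewrite !inE => /andP[wt wF].
by rewrite wt ub // !andbT; have := subsetP sub w wF; rewrite inE.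
Qed.

Section Strand.
Variables (v : V).
Hypothesis vP : v \in posL.
Implicit Types y z : {ffun {set V} -> k}.

Lemma cone_strict c y : supported le (below_strict v) c y ->
  forall F, cone v y F != 0 ->
  [/\ F \in faces c.+1, lab F = val v & v \in F].
Proof.
move=> Hu F; rewrite ffunE; case: ifP => [vF|]; last by rewrite eqxx.
rewrite mulf_eq0 negb_or => /andP[_ /Hu[chF /subsetP sub card]].
have ub w : w \in F -> le w v.
  move=> wF; have [->|wv] := eqVneq w v; first exact: lcm_le_refl.
  by have : w \in F :\ v by [rewrite !inE wv]; move=> /sub; rewrite inE => /and3P[].
split=> //; last exact: lab_max.
apply/facesP; split; last by rewrite (cardsD1 v) vF card.
  rewrite -(setD1K vF); apply/(chainU1 lcm_le_refl); split=> // w.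
  by rewrite inE => /andP[_ /ub wv]; rewrite /comparable wv orbT.
apply/subsetP => w wF; have [->//|wv] := eqVneq w v.
by have : w \in F :\ v by [rewrite !inE wv]; move=> /sub; rewrite inE => /andP[].
Qed.

(** On faces of label [v] the differential is the full boundary, and [y] vanishes there because its
    faces avoid [v]; so [boundary_cone] leaves only the second term. On the other nonempty faces
    both sides are zero. *)
Lemma tor_boundary_cone c y F : supported le (below_strict v) c y -> F != set0 ->
  tor_boundary (cone v y) F = - cone v (boundary y) F.
Proof.
move=> Hu F0.
have tE : tor_boundary (cone v y) F = if lab F == val v then boundary (cone v y) F else 0.
  rewrite [LHS]ffunE boundaryE; case: ifP => [/eqP labF|/eqP labF].
    apply: eq_bigr => w wF; congr (_ * _); case: eqP => // ne.
    apply/esym/eqP; apply: contra_notT ne => /(cone_strict Hu)[_ -> _].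
    by rewrite labF.
  apply: big1 => w wF; case: eqP => [e|]; last by rewrite mulr0.
  have [->|/(cone_strict Hu)[_ e' _]] := eqVneq (cone v y (w |: F)) 0; first by rewrite mulr0.
  by case: labF; rewrite -e.
rewrite {}tE.
have -> : boundary (cone v y) F = y F - cone v (boundary y) F.
  have /ffunP/(_ F) := boundary_cone v y.
  by move: (boundary _) (cone v (boundary y)) => y1 y2; rewrite ffunE => <-; rewrite addrK.
case: ifP => [/eqP labF|/eqP labF].
  suff -> : y F = 0 by rewrite sub0r.
  apply/eqP/negPn/negP => /Hu[chF /subsetP sub _].
  have [t tF ub] := chain_max chF F0; have := sub t tF.
  rewrite inE => /and3P[_ /eqP tv _]; case: tv.
  by apply: val_inj; rewrite -labF (lab_max tF ub).
apply/esym/eqP; rewrite oppr_eq0; apply: contra_notT labF.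
case: c Hu => [|c] Hu; first by rewrite (boundary_supported0 Hu) raddf0 ffunE eqxx.
by case/(cone_strict (supported_boundary Hu)).
Qed.

(** A chain whose label is [v] contains [v] as its maximum, and removing [v] leaves a chain strictly
    below it. *)
Lemma uncone c y :
  (forall F, y F != 0 -> F \in faces c.+1 /\ lab F = val v) ->
  exists2 y', supported le (below_strict v) c y' & y = cone v y'.
Proof.
move=> Hy.
exists [ffun F : {set V} => if v \in F then 0 else inc v F * y (v |: F)].
  move=> F; rewrite ffunE; case: ifP => vF; first by rewrite eqxx.
  rewrite mulf_eq0 negb_or => /andP[_ /Hy[vFF labF]].
  have [_ _ sub] := face_lab vFF labF.
  have /facesP[chF _ card] := vFF.
  split; first by apply: chainS chF; apply: subsetUr.
    by rewrite setU1K ?vF in sub.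
  by move: card; rewrite cardsU1 vF => -[].
apply/ffunP => F; rewrite !ffunE; case: ifP => vF.
  by rewrite setD11 setD1K // mulrA incidenceD1 incidence_sqr mul1r.
apply/eqP/negPn/negP => /Hy[FF labF].
by have [] := face_lab FF labF; rewrite vF.
Qed.

End Strand.

Lemma supported_ext c (z : 'rV[k]_#|faces c|) F : ext z F != 0 -> F \in faces c.
Proof. by apply: contraNT => /ext_out->. Qed.

(* The strand of multidegree [val v] of the resolution tensored with [k] is the
   augmented chain complex of the open interval below [v], shifted by one. *)
Lemma tor_vanishes_lcm_resolution i j :
  tor_vanishes R i j <->
  forall v, v \in posL -> (mdeg (val v))%:Z = j -> @acyclic_at k V le (below_strict v) i.
Proof.
split=> [tv v vP vj z Hz bz|ac z Hz cz].
  have Hy := cone_strict vP Hz.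
  pose zr : 'rV[k]_(rk R i) := \row_a cone v z (enum_val a).
  have extz F : ext zr F = cone v z F.
    rewrite (@ext_row _ _ (cone v z)) // => F' nF'; apply/eqP; apply: contraNT nF'.
    by case/Hy.
  have [a||w wE] := tv zr.
  - move=> naj; rewrite mxE; apply/eqP; apply: contra_notT naj => /Hy[_ labF _].
    by rewrite /= labF.
  - case: (i) zr extz Hz => //= l zr extz Hz; apply/rowP => b.
    rewrite dif_k_lcm_resolution [RHS]mxE.
    have -> : [ffun F => ext zr F] = cone v z by apply/ffunP => F; rewrite ffunE.
    rewrite (tor_boundary_cone vP Hz) ?bz ?raddf0 ?ffunE ?oppr0 //.
    by have /facesP[_ _ card] := enum_valP b; rewrite -card_gt0 card.
  (* Only the part of the filling with label [v] matters. It is a cone over some [y'], and the sign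
     in [tor_boundary_cone] makes [- y'] the filling of [z]. *)
  pose y : {ffun {set V} -> k} := [ffun F => if lab F == val v then ext w F else 0].
  have [|y' Hy' yE] := @uncone v i.+1 y.
    by move=> F; rewrite ffunE; case: ifP => [/eqP labF /supported_ext|]; rewrite ?eqxx.
  have zero : cone v (z + boundary y') = 0.
    have Hb := supported_boundary Hy'.
    apply/ffunP => F; rewrite [RHS]ffunE; apply/eqP/negPn/negP => nz.
    have [FF labF vF] := cone_strict vP (supportedD Hz Hb) nz.
    case/negP: nz; rewrite raddfD /=.
    have F0 : F != set0 by apply/set0Pn; exists v.
    have := tor_boundary_cone vP Hy' F0; rewrite -yE.
    have -> : tor_boundary y F = cone v z F.
      have [b bE] := face_enum FF.
      rewrite -extz bE ext_enum_val wE dif_k_lcm_resolution -bE !ffunE.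
      by apply: eq_bigr => u uF; rewrite !ffunE; case: eqP => // ->; rewrite labF eqxx.
    by move: (cone v z) (cone v (boundary y')) => y1 y2 e; rewrite ffunE e addNr.
  exists (- y'); first exact: supportedN.
  rewrite raddfN /=; apply/eqP; rewrite eq_sym -addr_eq0; apply/eqP.
  apply: (cone_eq0 (c := v)) zero => F vF; apply/eqP/negPn/negP.
  case/(supportedD Hz (supported_boundary Hy')) => _ /subsetP/(_ v vF).
  by rewrite inE eqxx /= andbF.
(* Conversely, [z] is split according to the maxima of its chains. Each part [y v] is filled
   separately by [t v], and the sum of these fillings is [w]. *)
pose y v : {ffun {set V} -> k} := [ffun F => if lab F == val v then ext z F else 0].
have yD v F : y v F = if lab F == val v then ext z F else 0 by rewrite ffunE.
have fill v : exists t : {ffun {set V} -> k}, (forall F, t F != 0 -> F \in faces i.+2) /\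
    (v \in posL -> (mdeg (val v))%:Z = j ->
     forall F, F != set0 -> tor_boundary t F = y v F).
  have t0 F : (0 : {ffun {set V} -> k}) F != 0 -> F \in faces i.+2 by rewrite ffunE eqxx.
  have [vP|] := boolP (v \in posL); last by exists 0.
  have [vj|/eqP nvj] := eqVneq ((mdeg (val v))%:Z : int) j; last by exists 0.
  have [|y' Hy' yE] := @uncone v i (y v).
    by move=> F; rewrite ffunE; case: ifP => [/eqP labF /supported_ext|]; rewrite ?eqxx.
  have [|t Ht bt] := ac v vP vj y' Hy'.
    case: (i) z cz y yD y' Hy' yE {Hz} => [|l] z cz y yD y' Hy' yE; first exact: boundary_supported0 Hy'.
    have Hb := supported_boundary Hy'.
    apply: (cone_eq0 (c := v)) => [F vF|].
      apply/eqP/negPn/negP; case/Hb => _ /subsetP/(_ v vF).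
      by rewrite inE eqxx /= andbF.
    apply/ffunP => F; rewrite [RHS]ffunE; apply/eqP/negPn/negP => nz.
    have [FF labF vF] := cone_strict vP Hb nz.
    have F0 : F != set0 by apply/set0Pn; exists v.
    have [b bE] := face_enum FF.
    case/negP: nz; rewrite -oppr_eq0 -(tor_boundary_cone vP Hy' F0) -yE.
    have /rowP/(_ b) := cz; rewrite dif_k_lcm_resolution -bE [in X in _ = X -> _]mxE => <-.
    apply/eqP; rewrite !ffunE; apply: eq_bigr => u uF; rewrite !ffunE.
    by congr (_ * _); case: eqP => // e; rewrite yD e labF eqxx.
  exists (- cone v t); split=> [F|_ _ F F0].
    by rewrite ffunE oppr_eq0 => /(cone_strict vP Ht)[].
  rewrite raddfN /= yE -bt -[RHS]opprK -(tor_boundary_cone vP Ht F0).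
  by move: (tor_boundary _) => y1; rewrite ffunE.
have [t tP] := fin_all_exists fill.
pose Q v := (v \in posL) && ((mdeg (val v))%:Z == j).
pose w : {ffun {set V} -> k} := \sum_(v | Q v) t v.
have w0 F : F \notin faces i.+2 -> w F = 0.
  move=> nF; rewrite sum_ffunE big1 // => v _; apply/eqP; apply: contraNT nF.
  by have [tF _] := tP v; apply: tF.
exists (\row_b w (enum_val b)); apply/rowP => a; rewrite dif_k_lcm_resolution.
have -> : [ffun F => ext (\row_(b < #|faces i.+2|) w (enum_val b)) F] = w.
  by apply/ffunP => F; rewrite ffunE ext_row.
have /facesP[chF /subsetP sub card] := enum_valP a.
have F0 : enum_val a != set0 by rewrite -card_gt0 card.
rewrite raddf_sum sum_ffunE.
transitivity (\sum_(v | Q v) y v (enum_val a)); last first.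
  by apply: eq_bigr => v /andP[vP /eqP vj]; have [_ ->] := tP v.
have [za|nza] := eqVneq (z 0 a) 0.
  by rewrite za big1 // => v _; rewrite ffunE ext_enum_val za if_same.
have [u uF ub] := chain_max chF F0; have labF := lab_max uF ub.
have uj : (mdeg (val u))%:Z = j.
  by apply/eqP; apply: contraNT nza => /eqP ne; rewrite Hz //= labF.
rewrite (bigD1 u) /=; last by rewrite /Q sub // uj eqxx.
rewrite ffunE labF eqxx ext_enum_val big1 ?addr0 // => v /andP[_ vu].
by rewrite ffunE labF ifF //; apply: contraNF vu => /eqP/val_inj->.
Qed.

Lemma linear_resolution_below d :
  linear_resolution d I <->
  forall i v, v \in posL -> mdeg (val v) <> (i + d)%N -> @acyclic_at k V le (below_strict v) i.
Proof.
split=> [lin i v vP ne|H i j ne].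
  have /tor_vanishes_lcm_resolution ac : tor_vanishes R i (mdeg (val v))%:Z.
    by apply/(betti_eq0 _ _ lcm_resolutionP)/lin; case.
  exact: ac.
apply/(betti_eq0 _ _ lcm_resolutionP)/tor_vanishes_lcm_resolution => v vP vj.
by apply: H => // e; apply: ne; rewrite -vj e.
Qed.

End Lattice.

(** * Grading and Cohen-Macaulayness *)

Section Grading.
Variables (k : fieldType) (n : nat) (I : {mpoly k[n]} -> Prop) (d : nat).
Hypothesis hI : monomial_ideal I.
Local Notation V := (lcm_lattice I).
Local Notation le := (@lcm_le k n I).
Local Notation pos := (posL I).
Implicit Types (u v w : V) (F : {set V}) (m : 'X_{1..n}).

Lemma strict_mdeg v w : strict le v w -> (mdeg (val v) < mdeg (val w))%N.
Proof.
case/andP=> neq vw; rewrite ltnNge; apply: contra neq => ge.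
by apply/eqP/val_inj/lem_mdeg_eq.
Qed.

Lemma cover_exists v w : strict le v w -> exists2 c, covers le v c & le c w.
Proof.
move=> vw; pose Q u := strict le v u && le u w.
have Qw : Q w by rewrite /Q vw lcm_le_refl.
case: (arg_minnP (fun u => mdeg (val u)) Qw) => c /andP[vc cw] min.
exists c => //; split=> // -[u [vu uc]].
have : Q u by rewrite /Q vu; case/andP: uc => _ /lcm_le_trans; apply.
by move/min; rewrite leqNgt strict_mdeg.
Qed.

Lemma cocover_exists v w : v \in pos -> w \in below_strict v ->
  exists2 c, c \in below_strict v & covers le c v.
Proof.
move=> vP wv; pose Q u := u \in below_strict v; have {wv} Qw : Q w := wv.
case: (arg_maxnP (fun u => mdeg (val u)) Qw) => c; rewrite {1}/Q => cv max.
exists c => //; move: (cv); rewrite inE => /and3P[cP nc le_cv].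
split=> [|[u [cu uv]]]; first by rewrite /strict nc.
have : Q u.
  rewrite /Q inE; case/andP: uv => -> ->; rewrite andbT andbT.
  by case/andP: cu => _; apply: posL_up.
by move/max; apply/negP; rewrite -ltnNge strict_mdeg.
Qed.

Lemma unit_lattice v w : v \in pos -> val v = 0%MM -> val w = 0%MM.
Proof.
case/posLP => g gG gv v0; apply: lepm_anti; last by apply/mnm_lepP => i; rewrite mnmE.
apply/lcm_leP => h hG hw; suff -> : h = g by rewrite -v0.
apply/esym/(mingens_antichain hI gG hG)/(lepm_trans gv).
by rewrite v0; apply/mnm_lepP => i; rewrite mnmE.
Qed.

(** If [v] or [w] were 1, membership of [v] in [posL] would force the lattice of the unit ideal or
    contradict the strict increase of degrees along the cover. *)
Lemma graded_pos v w : degree_graded I -> v \in pos -> covers le v w ->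
  mdeg (val w) = (mdeg (val v)).+1.
Proof.
move=> gr vP cov; have lt := strict_mdeg cov.1; apply: gr => // e.
  by move: lt; rewrite (unit_lattice w vP e) mdeg0.
by move: lt; rewrite e mdeg0.
Qed.

Lemma chain_card F lo hi : chain le F ->
  (forall w, w \in F -> (lo <= mdeg (val w) < hi)%N) -> (#|F| <= hi - lo)%N.
Proof.
move=> chF bounds; rewrite cardE -(size_map (fun w => mdeg (val w))) -(size_iota lo (hi - lo)).
apply: uniq_leq_size.
  rewrite map_inj_in_uniq ?enum_uniq // => v w; rewrite !mem_enum => vF wF e.
  apply: val_inj; have /orP[vw|wv] := chainP _ _ chF v w vF wF.
    by apply: lem_mdeg_eq => //; rewrite e.
  by apply/esym/lem_mdeg_eq => //; rewrite e.
move=> x /mapP[w]; rewrite mem_enum => /bounds /andP[lo_w w_hi] ->.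
by rewrite mem_iota lo_w; lia.
Qed.

(** * From a graded Cohen-Macaulay lattice to linearity *)

Section Equigenerated.
Hypothesis gen_deg : forall g, g \in mingens I -> mdeg g = d.

Lemma pos_deg v : v \in pos -> (d <= mdeg (val v))%N.
Proof. by case/posLP => g /gen_deg <-; apply: lem_mdeg. Qed.

(** Descending from [v] by covers lowers the degree by one each time, until a generator of degree
    [d] is reached. *)
Lemma long_chain N v : degree_graded I -> v \in pos -> mdeg (val v) = (d + N)%N ->
  exists F, [/\ chain le F, F \subset below_strict v & #|F| = N].
Proof.
move=> gr; elim: N v => [|N IH] v vP vN.
  by exists set0; rewrite chain0 sub0set cards0.
have /posLP[g gG gv] := vP; have [w wE] := lcm_gen gG.
have wv : w \in below_strict v.
  rewrite inE /lcm_le wE gv andbT; apply/andP; split.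
    by apply/posLP; exists g; rewrite // wE lepm_refl.
  by apply: contraTneq isT => e; move: vN; rewrite -e wE gen_deg //; lia.
have [c cv cov] := cocover_exists vP wv.
move: cv; rewrite inE => /and3P[cP nc le_cv].
have [|F [chF sub card]] := IH c cP.
  by apply/eqP; rewrite -eqSS -(graded_pos gr cP cov) vN addnS.
have cF : c \notin F by apply/negP => /(subsetP sub); rewrite inE eqxx andbF.
exists (c |: F); split.
- apply/(chainU1 (@lcm_le_refl _ _ _)); split=> // x /(subsetP sub).
  by rewrite inE => /and3P[_ _ xc]; rewrite /comparable xc orbT.
- apply/subsetP => x /setU1P[->|/(subsetP sub)]; first by rewrite inE cP nc.
  rewrite inE => /and3P[xP xc le_xc]; rewrite inE xP (lcm_le_trans le_xc le_cv) andbT /=.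
  apply: contraNneq nc => xv; apply/eqP/lcm_le_anti.
  by rewrite le_cv -xv.
by rewrite cardsU1 cF card.
Qed.

(* A maximal chain avoiding the elements strictly below [v] has the open interval
   below [v] as its link. *)
Lemma link_below_strict v : v \in pos ->
  exists2 F, chain le F & compat le F = below_strict v.
Proof.
move=> vP.
pose Q F := [&& chain le F, v \in F & [disjoint F & below_strict v]].
have Qv : Q [set v].
  rewrite /Q set11 disjoints1 inE eqxx andbF /= andbT.
  by apply/chainP => a b /set1P-> /set1P->; rewrite /comparable lcm_le_refl.
case: (arg_maxnP (fun F => #|F|) Qv) => F /and3P[chF vF disF] max.
exists F => //; apply/setP => u; apply/idP/idP => [/compatP[uF cmp]|uv].
  apply: contraLR uF => nu; rewrite negbK.
  have /max : Q (u |: F).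
    rewrite /Q setU1r // disjoints_subset subUset sub1set inE nu.
    rewrite -disjoints_subset disF !andbT.
    exact/(chainU1 (@lcm_le_refl _ _ _)).
  by rewrite cardsU1; case: (u \in F) => //=; rewrite ltnn.
apply/compatP; split=> [|w wF]; first by apply: contraTN uv => /(disjointFr disF)->.
have nw := disjointFr disF wF.
move: uv; rewrite inE => /and3P[uP uv le_uv].
have /orP[vw|wv] := chainP _ _ chF v w vF wF.
  by rewrite /comparable (lcm_le_trans le_uv vw).
have [->|neq] := eqVneq w v; first by rewrite /comparable le_uv.
move: nw; rewrite inE neq wv !andbT => /negbT/notin_posL w0.
rewrite /comparable orbC /lcm_le w0.
by apply/orP; left; apply/mnm_lepP => i; rewrite mnmE.
Qed.

Lemma acyclic_above_dim v c : v \in pos -> (mdeg (val v) < c + d)%N ->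
  @acyclic_at k V le (below_strict v) c.
Proof.
move=> vP lt z Hz _; have -> : z = 0.
  apply/ffunP => F; rewrite [RHS]ffunE; apply/eqP/negPn/negP => /Hz[chF sub card].
  suff : (#|F| <= mdeg (val v) - d)%N by rewrite card; have := pos_deg vP; lia.
  apply: chain_card => // w /(subsetP sub); rewrite inE => /and3P[wP wv le_wv].
  by rewrite pos_deg // strict_mdeg // /strict wv.
by exists 0; [apply: supported0 | rewrite raddf0].
Qed.

(** Above degree [deg v - d] there are no chains. Below it, the interval is the link of a chain, and
    [long_chain] shows that its dimension exceeds [c - 1]. *)
Lemma cm_acyclic v c : degree_graded I -> cohen_macaulay_poset k le ->
  v \in pos -> mdeg (val v) <> (c + d)%N -> @acyclic_at k V le (below_strict v) c.
Proof.
move=> gr cm vP ne.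
have [lt|ge] := ltnP (mdeg (val v)) (c + d); first exact: acyclic_above_dim.
have [F chF FE] := link_below_strict vP; rewrite -FE.
apply/(reduced_homology_link k c chF)/cm => //.
have [T [chT subT cardT]] := @long_chain (mdeg (val v) - d) v gr vP (esym (subnKC (pos_deg vP))).
rewrite /dim Num.Theory.ltrD2r ltz_nat.
apply: (@leq_trans #|T|); first by rewrite cardT; lia.
by apply: leq_bigmax_cond; rewrite mem_link // chT FE.
Qed.

End Equigenerated.

(** * From linearity to the grading *)

Section Linear.
Hypothesis lin : forall c v, v \in pos -> mdeg (val v) <> (c + d)%N ->
  @acyclic_at k V le (below_strict v) c.

(** The open interval below a generator is empty, so its empty face carries a nonzero class in
    dimension -1, which linearity allows only in degree [d]. *)
Lemma linear_gen_deg g : g \in mingens I -> mdeg g = d.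
Proof.
move=> gG; have [v vE] := lcm_gen gG.
apply/eqP/negPn/negP => /eqP ne.
have vP : v \in pos by apply/posLP; exists g; rewrite // vE lepm_refl.
have v0 : below_strict v = set0.
  apply/setP => w; rewrite in_set0 inE; apply/negP => /and3P[/posLP[h hG hw] wv le_wv].
  have hg : h = g by apply: (mingens_antichain hI) => //; rewrite -vE; apply: lepm_trans le_wv.
  by case/eqP: wv; apply: val_inj; apply: lepm_anti le_wv _; rewrite vE -hg.
have := lin (c := 0) vP; rewrite vE add0n v0 => /(_ ne).
pose z : {ffun {set V} -> k} := [ffun F : {set V} => (F == set0)%:R].
have Hz : supported le set0 0 z.
  move=> F; rewrite ffunE; case: (eqVneq F set0) => [-> _|_]; last by rewrite eqxx.
  by rewrite chain0 sub0set cards0.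
case/(_ z Hz (boundary_supported0 Hz)) => y Hy /ffunP/(_ set0).
have -> : y = 0.
  apply/ffunP => F; rewrite [RHS]ffunE; apply/eqP/negPn/negP => /Hy[_].
  by rewrite subset0 => /eqP->; rewrite cards0.
by rewrite raddf0 !ffunE eqxx => /esym/eqP; rewrite oner_eq0.
Qed.

(** Take generators [h] dividing [a] and [g] dividing [b] but not [a], with lcm [m] of least degree.
    If this degree is [d + 1], joining [a] with [g] gives [b] and costs one degree. Otherwise
    linearity makes the interval below [m] connected, while minimality separates the divisors of [a]
    in it from the other elements. *)
Lemma linear_graded : degree_graded I.
Proof.
move=> a b /eqP a0 _ cov; have [/andP[nab le_ab] nocover] := cov.
have aP : a \in pos by apply: contraNT a0 => /notin_posL/eqP.
pose Q (p : V * V) := [&& val p.1 \in mingens I, val p.2 \in mingens I,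
  le p.1 a, ~~ le p.2 a & le p.2 b].
have [p0 Qp0] : exists p, Q p.
  have /posLP[h hG ha] := aP; have [vh vhE] := lcm_gen hG.
  have [g [gG gb nga]] : exists g, [/\ g \in mingens I, (g <= val b)%MM & ~~ (g <= val a)%MM].
    apply: NNPP => H; case/eqP: nab; apply: lcm_le_anti; rewrite le_ab /=.
    apply/lcm_leP => g gG gb; apply/negPn/negP => nga; apply: H.
    by exists g.
  have [vg vgE] := lcm_gen gG.
  by exists (vh, vg); rewrite /Q /lcm_le /= vhE vgE hG ha gG gb nga.
case: (arg_minnP (fun p => mdeg (mlcm (val p.1) (val p.2))) Qp0).
move=> [vh vg]; rewrite {1}/Q /= => /and5P[hG gG ha nga gb] min.
have [m mE] := lcm_join vh vg.
have hm : le vh m by rewrite /lcm_le mE lem_mlcml.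
have gm : le vg m by rewrite /lcm_le mE lem_mlcmr.
have mb : le m b by rewrite /lcm_le mE lem_mlcm; apply/andP; split; [apply: lcm_le_trans le_ab | ].
have hP : vh \in pos by apply/posLP; exists (val vh); rewrite ?lepm_refl.
have gP : vg \in pos by apply/posLP; exists (val vg); rewrite ?lepm_refl.
have mP : m \in pos := posL_up hP hm.
have [dm|dm] := eqVneq (mdeg (val m)) d.+1.
  have [j jE] := lcm_join a vg.
  have aj : strict le a j.
    rewrite /strict /lcm_le jE lem_mlcml andbT; apply: contraNneq nga => ->.
    by rewrite /lcm_le jE lem_mlcmr.
  have jb : j = b.
    apply/eqP/negPn/negP => njb; apply: nocover; exists j; split=> //.
    by rewrite /strict njb /lcm_le jE lem_mlcm; apply/and3P; split.
  apply/eqP; rewrite eqn_leq strict_mdeg ?andbT; last by rewrite /strict nab.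
  have dh : mdeg (val vh) = d by apply: linear_gen_deg.
  (* What [g] adds to [h] has degree one, and it adds no more to the multiple [a] of [h]. *)
  move: dm; rewrite mE -jb jE !mlcmE !mdegD dh -addn1 => /addnI dgh.
  rewrite -addn1 leq_add2l -dgh; apply: lem_mdeg; apply/mnm_lepP => i.
  by rewrite !mnmBE leq_sub2l //; move/mnm_lepP: ha.
have ne1 : mdeg (val m) <> (1 + d)%N by apply/eqP.
have ab_ne (h g : V) : val h \in mingens I -> val g \in mingens I -> le h a -> ~~ le g a ->
    le g b -> (mdeg (val m) <= mdeg (mlcm (val h) (val g)))%N.
  by move=> *; rewrite mE; apply: (min (_, _)); apply/and5P.
pose A := [set u | le u a].
have hA : vh \in A by rewrite inE.
have gA : vg \notin A by rewrite inE.
have nhm : vh != m.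
  by apply: contraNneq nga => e; apply: lcm_le_trans ha; rewrite e.
have ngm : vg != m.
  apply: contraNneq nga => e; have le_hg : le vh vg by rewrite e.
  by rewrite -(val_inj (mingens_antichain hI hG gG le_hg)).
(* A comparable pair violating this would yield generators with a smaller lcm,
   against the choice of [vh] and [vg]. *)
have sep u w : u \in below_strict m -> w \in below_strict m -> comparable le u w ->
    u \in A -> w \in A.
  rewrite inE => /and3P[uP _ _]; rewrite inE => /and3P[_ wm le_wm] uw; rewrite inE => ua.
  rewrite inE; apply/negPn/negP => nwa.
  have {uw} uw : le u w.
    by case/orP: uw => // wu; case/negP: nwa; apply: lcm_le_trans ua.
  have [g [g_gen gw nga']] : exists g, [/\ g \in mingens I, (g <= val w)%MM & ~~ (g <= val a)%MM].
    apply: NNPP => H; case/negP: nwa.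
    apply/lcm_leP => g g_gen gw; apply/negPn/negP => nga'; apply: H.
    by exists g.
  have /posLP[h h_gen hu] := uP.
  have [vh' vh'E] := lcm_gen h_gen; have [vg' vg'E] := lcm_gen g_gen.
  have := ab_ne vh' vg'; rewrite /lcm_le vh'E vg'E => /(_ h_gen g_gen (lepm_trans hu ua) nga').
  move=> /(_ (lepm_trans gw (lcm_le_trans le_wm mb))); apply/negP; rewrite -ltnNge.
  apply: leq_ltn_trans (strict_mdeg (v := w) (w := m) _); last by rewrite /strict wm.
  by apply: lem_mdeg; rewrite lem_mlcm gw (lepm_trans hu uw).
pose z : {ffun {set V} -> k} := [ffun F : {set V} => (F == [set vh])%:R - (F == [set vg])%:R].
have Hz : supported le (below_strict m) 1 z.
  have one v : v \in below_strict m ->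
      [/\ chain le [set v], [set v] \subset below_strict m & #|[set v]| = 1%N].
    move=> vm; rewrite sub1set cards1; split=> //.
    by apply/chainP => x y /set1P-> /set1P->; rewrite /comparable lcm_le_refl.
  move=> F; rewrite ffunE; case: (eqVneq F [set vh]) => [-> _|_].
    by apply: one; rewrite inE hP nhm.
  case: (eqVneq F [set vg]) => [-> _|_]; last by rewrite subrr eqxx.
  by apply: one; rewrite inE gP ngm.
have z1 v : z [set v] = (v == vh)%:R - (v == vg)%:R.
  by rewrite ffunE !(inj_eq set1_inj).
have inc0 v : @incidence k V v set0 = 1.
  rewrite /incidence [X in _ ^+ X](_ : _ = 0%N) //.
  by apply/eqP; rewrite cards_eq0; apply/eqP/setP => x; rewrite !inE.
have boundary_at0 (x : {ffun {set V} -> k}) : boundary x set0 = \sum_v x [set v].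
  rewrite boundaryE; apply: eq_big => [v|v _]; first by rewrite inE.
  by rewrite inc0 mul1r setU0.
have sum_delta v : \sum_w (w == v)%:R = 1 :> k.
  by rewrite (bigD1 v) //= eqxx big1 ?addr0 // => w /negPf->.
have bz : boundary z = 0.
  apply/ffunP => F; rewrite [RHS]ffunE; apply/eqP/negPn/negP => nz.
  have [_ _ /cards0_eq F0] := supported_boundary Hz nz.
  case/negP: nz; rewrite F0 boundary_at0 (eq_bigr _ (fun v _ => z1 v)) sumrB.
  by rewrite !sum_delta subrr.
have [y Hy by_] := lin mP ne1 Hz bz.
(* By [sep] no edge of [y] leaves [A], so the restriction of [y] to [A] has boundary the single
   vertex [vh]. Its coefficient sum is 1, against [boundary_boundary]. *)
pose y' : {ffun {set V} -> k} := [ffun F : {set V} => if F \subset A then y F else 0].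
have by' u : boundary y' [set u] = if u \in A then z [set u] else 0.
  rewrite -by_ !boundaryE; case: ifP => uA; last first.
    by apply: big1 => w _; rewrite ffunE subUset !sub1set uA andbF mulr0.
  apply: eq_bigr => w wu; congr (_ * _); rewrite ffunE subUset !sub1set uA andbT.
  case: ifP => // wA; apply/esym/eqP/negPn/negP => /Hy[chF /subsetP sub _].
  have wF : w \in w |: [set u] by rewrite setU11.
  have uF : u \in w |: [set u] by rewrite !inE eqxx orbT.
  by rewrite (sep _ _ (sub u uF) (sub w wF) (chainP _ _ chF u w uF wF) uA) in wA.
have /ffunP/(_ set0) := boundary_boundary y'.
rewrite boundary_at0 [RHS]ffunE (eq_bigr _ (fun v _ => by' v)) (bigD1 vh) //= hA z1 eqxx.
have -> : (vh == vg) = false by apply: contraNF gA => /eqP<-.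
rewrite subr0 big1 ?addr0 => [/eqP|w wh]; first by rewrite oner_eq0.
case: ifP => // wA; rewrite z1 (negPf wh) sub0r.
by have -> : (w == vg) = false; [apply: contraTF wA => /eqP-> | rewrite oppr0].
Qed.

(** * From linearity to Cohen-Macaulay links *)

Lemma saturated v F e : degree_graded I -> chain le F -> v \in F -> v \in pos ->
  (forall w, w \in compat le F -> ~~ strict le v w) ->
  forall t, t \in F -> (forall w, le w t) ->
  (mdeg (val v) <= e <= mdeg (val t))%N ->
  exists x, [/\ x \in F, x \in pos, le v x & mdeg (val x) = e].
Proof.
move=> gr chF vF vP sat t tF top.
elim: e => [|e IH] /andP[lo hi].
  by exists v; rewrite lcm_le_refl vF vP; split=> //; move: lo; rewrite leqn0 => /eqP.
move: lo; rewrite leq_eqVlt => /orP[/eqP e1|lo]; first by exists v; rewrite lcm_le_refl.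
have [|x [xF xP vx xe]] := IH; first by rewrite -ltnS lo ltnW.
pose Q y := (y \in F) && strict le x y.
have Qt : Q t.
  rewrite /Q tF /strict top andbT; apply: contraTneq hi => <-.
  by rewrite xe ltnn.
(* Let [y] be the element of [F] following [x], and [c] a cover of [x] below [y]. If [c] were not in
   [F], it would be compatible with [F], against [sat]. *)
case: (arg_minnP (fun y => mdeg (val y)) Qt) => y /andP[yF xy] min.
have [c cov cy] := cover_exists xy.
have ce : mdeg (val c) = e.+1 by rewrite (graded_pos gr xP cov) xe.
have [/andP[nxc xc] _] := cov.
exists c; split=> //; [|exact: posL_up xc|exact: lcm_le_trans xc].
apply/negPn/negP => cF; have /sat/negP[] : c \in compat le F.
  apply/compatP; split=> // w wF.
  have /orP[wx|xw] := chainP _ _ chF w x wF xF.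
    by rewrite /comparable (lcm_le_trans wx xc) orbT.
  have [->|nwx] := eqVneq w x; first by rewrite /comparable xc orbT.
  have yw : le y w.
    have /orP[//|wy] := chainP _ _ chF y w yF wF.
    have [->|neq] := eqVneq w y; first exact: lcm_le_refl.
    have : Q w by rewrite /Q wF /strict xw eq_sym nwx.
    by move/min; rewrite leqNgt strict_mdeg // /strict neq.
  by rewrite /comparable (lcm_le_trans cy yw).
rewrite /strict (lcm_le_trans vx xc) andbT; apply: contraTneq isT => vc.
by case/negP: nxc; apply/eqP/lcm_le_anti; rewrite xc -vc.
Qed.

(** As [u] is a multiple of [a] but not of [a x_l], both have the same exponent at [x_l]; so the lcm
    only multiplies [u] by [x_l]. *)
Lemma lcm_cover_shift (a c u : V) l : val c = (U_(l) + val a)%MM -> le a u -> ~~ le c u ->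
  mlcm (val u) (val c) = (U_(l) + val u)%MM.
Proof.
move=> cE /mnm_lepP au ncu; have ul : val u l = val a l.
  apply/eqP; rewrite eqn_leq au andbT leqNgt; apply: contra ncu => lt.
  apply/mnm_lepP => i; rewrite cE mnmDE mnm1E.
  by case: (eqVneq l i) => [<-|_]; rewrite ?add1n ?add0n.
apply/mnmP => i; rewrite cE !mnmE.
case: (eqVneq l i) => [<-|_]; last by rewrite !add0n; apply/maxn_idPl/au.
by rewrite ul; apply/maxn_idPr; rewrite add1n.
Qed.

(** If [a] is the least element of [F] in [pos], the link is the open interval below [a], and [F]
    without [bot] meets every degree from [deg a] to [deg top]. The size bound then excludes
    [deg a = c + d], the one degree not covered by linearity. *)
Lemma link_acyclic_gap bot top F c : degree_graded I -> val bot = 0%MM -> (forall w, le w top) ->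
  chain le F -> bot \in F -> top \in F -> top \in pos -> bot \notin pos ->
  (forall x w, x \in F -> x \in pos -> w \in compat le F -> ~~ strict le x w) ->
  (c + #|F| + d < mdeg (val top) + 2)%N ->
  @acyclic_at k V le (compat le F) c.
Proof.
move=> gr bot0 top_ub chF botF topF topP botP nogap size_lt.
pose Q x := (x \in F) && (x \in pos).
have Qtop : Q top by rewrite /Q topF.
case: (arg_minnP (fun y => mdeg (val y)) Qtop) => a /andP[aF aP] min.
have -> : compat le F = below_strict a.
  apply/setP => w; apply/idP/idP => [wF|].
    have /compatP[nwF cmp] := wF.
    have nwa : w != a by apply: contraNneq nwF => ->.
    have /orP[wa|aw] := cmp a aF; last first.
      by have := nogap a w aF aP wF; rewrite /strict eq_sym nwa aw.
    rewrite inE nwa wa andbT andbT; apply: contraNT nwF => /notin_posL w0.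
    by rewrite (_ : w = bot) //; apply: val_inj; rewrite w0 bot0.
  rewrite inE => /and3P[wP nwa wa]; apply/compatP.
  have lt : (mdeg (val w) < mdeg (val a))%N by apply: strict_mdeg; rewrite /strict nwa.
  split=> [|x xF].
    by apply/negP => wF; have := min w; rewrite /Q wF wP leqNgt lt => /(_ isT).
  have [xP|xP] := boolP (x \in pos); last first.
    rewrite /comparable orbC /lcm_le (notin_posL xP).
    by apply/orP; left; apply/mnm_lepP => i; rewrite mnmE.
  suff ax : le a x by rewrite /comparable (lcm_le_trans wa ax).
  have /orP[//|xa] := chainP _ _ chF a x aF xF.
  rewrite (val_inj (lem_mdeg_eq xa _)) ?lcm_le_refl //.
  by apply: min; rewrite /Q xF.
apply: lin => // ac.
have lt_at : (mdeg (val a) <= mdeg (val top))%N by apply/lem_mdeg/top_ub.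
have : (mdeg (val top) - mdeg (val a) + 1 <= #|F :\ bot|)%N.
  rewrite -(size_iota (mdeg (val a)) (mdeg (val top) - mdeg (val a) + 1)).
  rewrite cardE -(size_map (fun w => mdeg (val w))); apply: uniq_leq_size; first exact: iota_uniq.
  move=> e; rewrite mem_iota addnA subnKC // addn1 ltnS => e_in.
  have [|x [xF xP _ <-]] := saturated gr chF aF aP _ topF top_ub e_in.
    by move=> w; apply: nogap.
  by apply: map_f; rewrite mem_enum !in_setD1 xF andbT; apply: contraNneq botP => <-.
move: lt_at size_lt; rewrite (cardsD1 bot F) botF ac add1n; clear.
by move: (mdeg _) #|_| => x y; lia.
Qed.

(** Induction on the size of the link. A chain from [bot] to [top] through all degrees from [d] on
    has [deg top - d + 2] elements; the bound says that [F] falls short of this by more than [c]. *)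
Lemma link_acyclic bot top F c : degree_graded I -> val bot = 0%MM -> (forall w, le w top) ->
  chain le F -> bot \in F -> top \in F -> top \in pos -> bot \notin pos ->
  (c + #|F| + d < mdeg (val top) + 2)%N ->
  @acyclic_at k V le (compat le F) c.
Proof.
move=> gr bot0 top_ub.
have [N] := ubnP #|compat le F|; elim: N => // N IH in F c * => ltN chF botF topF topP botP size_lt.
have [/existsP[a0 /existsP[w /and4P[a0F a0P wW a0w]]]|nogap] :=
  boolP [exists x, exists w, [&& x \in F, x \in pos, w \in compat le F & strict le x w]];
  last first.
  apply: (link_acyclic_gap gr bot0 top_ub) => // x w xF xP wF; apply: contra nogap => xw.
  by apply/existsP; exists x; apply/existsP; exists w; apply/and4P.
have /compatP[nwF cmpw] := wW.
pose Qa x := (x \in F) && strict le x w; pose Qb x := (x \in F) && strict le w x.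
have Qa0 : Qa a0 by rewrite /Qa a0F.
have Qtop : Qb top by rewrite /Qb topF /strict top_ub andbT; apply: contraNneq nwF => ->.
(* The consecutive elements [a] and [b] of [F] enclosing [w] delimit a gap; [c0] will be a cover of
   [a] inside it. *)
case: (arg_maxnP (fun y => mdeg (val y)) Qa0) => a /andP[aF /andP[naw aw]] maxa.
case: (arg_minnP (fun y => mdeg (val y)) Qtop) => b /andP[bF /andP[nwb wb]] minb.
have aP : a \in pos.
  have /orP[a0a|aa0] := chainP _ _ chF a0 a a0F aF; first exact: posL_up a0a.
  by rewrite (val_inj (lem_mdeg_eq aa0 (maxa _ Qa0))).
have split_F x : x \in F -> le x a || le b x.
  move=> xF; have nxw : x != w by apply: contraNneq nwF => <-.
  have /orP[wx|xw] := cmpw x xF.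
    have /orP[bx|xb] := chainP _ _ chF b x bF xF; first by rewrite bx orbT.
    rewrite (val_inj (lem_mdeg_eq xb _)) ?lcm_le_refl ?orbT //.
    by apply: minb; rewrite /Qb xF /strict eq_sym nxw.
  have /orP[ax|->//] := chainP _ _ chF a x aF xF.
  rewrite -(val_inj (lem_mdeg_eq ax _)) ?lcm_le_refl //.
  by apply: maxa; rewrite /Qa xF /strict nxw.
have strict_aw : strict le a w by rewrite /strict naw.
have [c0 cov c0w] := cover_exists strict_aw.
have [/andP[nac0 ac0] _] := cov.
have c0b : le c0 b := lcm_le_trans c0w wb.
have nc0a : ~~ le c0 a by apply: contra nac0 => c0a; apply/eqP/lcm_le_anti/andP.
have nbc0 : ~~ le b c0.
  apply: contra nwb => bc0; apply/eqP/lcm_le_anti.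
  by rewrite wb (lcm_le_trans bc0 c0w).
have [l c0E] : exists l, val c0 = (U_(l) + val a)%MM.
  have /mdeg1P[l /eqP lE] : mdeg (val c0 - val a)%MM == 1%N.
    have := graded_pos gr aP cov; rewrite -{1}(submK ac0) mdegD -add1n.
    by move/addIn/eqP.
  by exists l; rewrite -lE submK.
have compat_between j : le a j -> le j b -> ~~ le j a -> ~~ le b j -> j \in compat le F.
  move=> aj jb nja nbj; apply/compatP; split=> [|x xF].
    by apply/negP => /split_F; rewrite (negPf nja) (negPf nbj).
  have /orP[xa|bx] := split_F x xF; rewrite /comparable.
    by rewrite (lcm_le_trans xa aj) orbT.
  by rewrite (lcm_le_trans jb bx).
have c0W : c0 \in compat le F by apply: compat_between.
(* An element of the link incomparable to [c0] lies between [a] and [b]. Its join with [c0]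
   multiplies it by [x_l] and stays in the link unless it equals [b]. *)
have shift u j : u \in compat le F -> ~~ comparable le u c0 -> val j = mlcm (val u) (val c0) ->
    [/\ val j = (U_(l) + val u)%MM, le j b & j != b -> j \in compat le F].
  move=> /compatP[_ cmpu] ncmp jE.
  have au : le a u.
    have /orP[ua|//] := cmpu a aF.
    by case/negP: ncmp; rewrite /comparable (lcm_le_trans ua ac0).
  have ub : le u b.
    have /orP[//|bu] := cmpu b bF.
    by case/negP: ncmp; rewrite /comparable (lcm_le_trans c0b bu) orbT.
  have nc0u : ~~ le c0 u by apply: contra ncmp => h; rewrite /comparable h orbT.
  have uj : le u j by rewrite /lcm_le jE lem_mlcml.
  have c0j : le c0 j by rewrite /lcm_le jE lem_mlcmr.
  have jb : le j b by rewrite /lcm_le jE lem_mlcm; apply/andP.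
  split=> // [|njb]; first by rewrite jE (lcm_cover_shift c0E).
  apply: compat_between => //; first exact: lcm_le_trans uj.
    by apply: contra nc0a; apply: lcm_le_trans.
  by apply: contra njb => bj; apply/eqP/lcm_le_anti/andP.
have join_lub u j : val j = mlcm (val u) (val c0) ->
    [/\ le u j, le c0 j & forall v, le u v -> le c0 v -> le j v].
  move=> jE; rewrite /lcm_le jE lem_mlcml lem_mlcmr; split=> // v uv c0v.
  by rewrite lem_mlcm; apply/andP.
(* The only join with [c0] that may leave the gap is the join with [b / x_l]. *)
have [/existsP[c1 /and3P[c1W ncmp1 /eqP c1b]]|nob] := boolP [exists u,
    [&& u \in compat le F, ~~ comparable le u c0 & val b == mlcm (val u) (val c0)]]; last first.
  apply: (acyclic_join_all (@lcm_le_refl _ _ _) (@lcm_le_anti _ _ _) (@lcm_le_trans _ _ _) c0W).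
  move=> u uW ncmp; have [j jE] := lcm_join u c0.
  have [_ _ jW] := shift u j uW ncmp jE; have [uj c0j lub] := join_lub u j jE.
  exists j; last by split=> // v _; apply: lub.
  apply: jW; apply: contraNneq nob => jb.
  by apply/existsP; exists u; rewrite uW ncmp -jb jE eqxx.
have c10 : c1 != c0 by apply: contraNneq ncmp1 => ->; rewrite /comparable lcm_le_refl.
have [b_shift _ _] := shift c1 b c1W ncmp1 c1b.
apply: (acyclic_add_vertex (@lcm_le_refl _ _ _) c1W).
  apply: (acyclic_join_all (@lcm_le_refl _ _ _) (@lcm_le_anti _ _ _) (@lcm_le_trans _ _ _) (c := c0)).
    by rewrite !in_setD1 eq_sym c10.
  move=> u; rewrite in_setD1 => /andP[uc1 uW] ncmp; have [j jE] := lcm_join u c0.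
  have [j_shift _ jW] := shift u j uW ncmp jE; have [uj c0j lub] := join_lub u j jE.
  exists j; last by split=> // v _; apply: lub.
  rewrite in_setD1 jW ?andbT.
    by apply: contraNneq ncmp1 => <-; rewrite /comparable c0j orbT.
  (* Cancelling [x_l] shows that [c1] is the only element whose join with [c0] is [b]. *)
  apply: contraNneq uc1 => jb; apply/eqP/val_inj/(@addmI _ U_(l)%MM).
  by rewrite -j_shift -b_shift jb.
(* The link of [c1] in the link of [F] is that of [c1 |: F]: the chain gains one element while [c]
   drops by one, which preserves the bound. *)
move=> c_gt0; have /compatP[c1F cmp1] := c1W.
rewrite neighbours_compat.
apply: IH; rewrite ?setU1r //.
- apply: (@leq_trans #|compat le F|); last by rewrite -ltnS.
  apply/proper_card/properP; split.
    apply/subsetP => u /compatP[uF cmpu]; apply/compatP; split.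
      by apply: contra uF; apply: setU1r.
    by move=> x xF; apply: cmpu; rewrite setU1r.
  by exists c1 => //; apply/negP => /compatP[]; rewrite setU11.
- exact/(chainU1 (@lcm_le_refl _ _ _)).
move: size_lt c_gt0; rewrite cardsU1 c1F add1n; clear.
by move: (mdeg _) #|_| => x y; lia.
Qed.

Lemma linear_cm : cohen_macaulay_poset k le.
Proof.
have gr := linear_graded; have gd := linear_gen_deg.
have [top topP] := lcm_of_gens I predT.
have top_ub w : le w top.
  by apply/lcm_leP => g gG _; have /topP := lepm_refl (val top); apply.
have [bot botP] := lcm_of_gens I pred0.
have bot0 : val bot = 0%MM.
  by apply: lepm_anti; [apply/botP | apply/mnm_lepP => i; rewrite mnmE].
have bot_lb w : le bot w by rewrite /lcm_le bot0; apply/mnm_lepP => i; rewrite mnmE.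
move=> F chF i lt_dim.
have [neg|ge] := boolP (i < -1); first exact: reduced_homology_neg.
have [c ci] : exists c : nat, i = c%:Z - 1.
  by exists `|(i + 1)%R|%N; move: ge; rewrite -Order.TotalTheory.leNgt; clear; lia.
rewrite ci in lt_dim *; apply/(reduced_homology_link k c chF).
(* A chain missing the top or the bottom of the lattice has a cone as its link. *)
have cone_at x : (forall w, comparable le w x) -> x \notin F ->
    @acyclic_at k V le (compat le F) c.
  move=> cmp xF; apply: (acyclic_cone (@lcm_le_refl _ _ _) (c := x)).
    by apply/compatP; split=> // w _; rewrite comparable_sym.
  by move=> w _; apply: cmp.
have [topF|] := boolP (top \in F); last by apply: cone_at => w; rewrite /comparable top_ub.
have [botF|] := boolP (bot \in F); last by apply: cone_at => w; rewrite /comparable bot_lb orbT.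
have [T TL cT] : exists2 T, T \in link (order_complex le) F & (c < #|T|)%N.
  apply: NNPP => H; move: lt_dim; rewrite /dim Num.Theory.ltrD2r ltz_nat.
  apply/negP; rewrite -leqNgt; apply/bigmax_leqP => T TL.
  by rewrite leqNgt; apply/negP => cT; apply: H; exists T.
move: TL; rewrite inE => /and3P[_ chTF /eqP dis].
(* The nonempty chain [T] is disjoint from [F], which contains [bot], so the lattice is not reduced
   to 1. *)
have trivial_lattice : (forall w, val w = 0%MM) -> False.
  move=> all0; have [t tT] : exists t, t \in T by apply/set0Pn; rewrite -card_gt0; case: (#|T|) cT.
  have tbot : t = bot by apply: val_inj; rewrite all0 bot0.
  by have := in_set0 t; rewrite -dis inE tT tbot botF.
have topP' : top \in pos.
  apply/negPn/negP => /notin_posL top0; apply: trivial_lattice => w.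
  apply: lepm_anti; last by apply/mnm_lepP => l; rewrite mnmE.
  by rewrite -top0; apply: top_ub.
have botP' : bot \notin pos by apply/negP => bP; apply: trivial_lattice => w; apply: unit_lattice bP bot0.
apply: (link_acyclic gr bot0 top_ub) => //.
(* Away from [bot], the chain [T :|: F] has distinct degrees between [d] and [deg top]. With more
   than [c] elements in [T], this yields the size bound. *)
have : (#|(T :|: F) :\ bot| <= (mdeg (val top)).+1 - d)%N.
  apply: chain_card => [|w]; first by apply: chainS chTF; apply: subD1set.
  rewrite in_setD1 => /andP[wbot _]; rewrite ltnS lem_mdeg ?andbT; last exact: top_ub.
  apply: (pos_deg gd); apply: contraNT wbot => /notin_posL w0.
  by apply/eqP/val_inj; rewrite w0 bot0.
have := cardsD1 bot (T :|: F); rewrite inE botF orbT cardsU dis cards0 subn0 add1n.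
have := pos_deg gd topP'; move: cT; clear.
by move: (mdeg _) #|_ :\ _| #|T| #|F| => x y t f; lia.
Qed.

End Linear.
End Grading.

Theorem theorem1p3 (k : fieldType) (n : nat) (I : {mpoly k[n]} -> Prop) (d : nat)
    (hI : monomial_ideal I) :
  linear_resolution d I <->
  d_degree_graded d I /\ cohen_macaulay_poset k (@lcm_le k n I).
Proof.
rewrite (linear_resolution_below hI); split=> [lin|[[gr gd] cm] c v vP].
  have lin' c v (vP : v \in posL I) := @lin c v vP.
  split; last exact: (linear_cm hI lin').
  by split; [apply: (linear_graded hI lin') | apply: (linear_gen_deg hI lin')].
exact: (cm_acyclic hI gd gr cm vP).
Qed.
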